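(* Let $s:\mathcal{F}\to\mathbb{R}$ be a function on the edges of the Farey tesselation $\mathcal{F}$ of the unit disk $\mathbb{D}$. Then $s=s_h$ for some quasisymmetric map $h:S^1\to S^1$ fixing $1,i,-1$ if and only if there exists a constant $M\geq 1$ such that for every fan $\mathcal{F}^p=\{f_n^p\}_{n\in\mathbb{Z}}$ of $\mathcal{F}$, and for all $m\in\mathbb{Z}$ and $k\in\mathbb{N}\cup\{0\}$, $$\frac{1}{M}\leq e^{s(f_m^p)}\,\frac{1+e^{s(f_{m+1}^p)}+e^{s(f_{m+1}^p)+s(f_{m+2}^p)}+\cdots+e^{s(f_{m+1}^p)+\cdots+s(f_{m+k}^p)}}{1+e^{-s(f_{m-1}^p)}+e^{-s(f_{m-1}^p)-s(f_{m-2}^p)}+\cdots+e^{-s(f_{m-1}^p)-\cdots-s(f_{m-k}^p)}}\leq M .$$ Equivalently, if $\delta_n^p>0$ are numbers with $\delta_n^p/\delta_{n-1}^p=e^{s(f_n^p)}$ for all $n$ (for $s=s_h$, these are the lengths of the arcs of a horocycle $C$ at $h(p)$ lying between $h(f_n^p)$ and $h(f_{n+1}^p)$), the condition reads $$\frac{1}{M}\leq\frac{\delta_m^p+\delta_{m+1}^p+\cdots+\delta_{m+k}^p}{\delta_{m-1}^p+\delta_{m-2}^p+\cdots+\delta_{m-k-1}^p}\leq M.$$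
   Context: $\mathbb{D}=\{|z|<1\}$ carries the hyperbolic metric $2|dz|/(1-|z|^2)$ with ideal boundary $S^1$; a geodesic is identified with its pair of ideal endpoints. Let $\Delta_0$ be the ideal triangle with vertices $1,i,-1$. The Farey tesselation $\mathcal{F}$ is the ideal triangulation of $\mathbb{D}$ obtained by repeatedly reflecting $\Delta_0$ in its sides; $\mathcal{F}$ is identified with its set of edges. For an orientation preserving homeomorphism $h:S^1\to S^1$ fixing $1,i,-1$, $h(\mathcal{F})$ denotes the ideal triangulation whose edges have endpoints the $h$-images of endpoints of edges of $\mathcal{F}$. Shear: for an edge $f\in\mathcal{F}$ with adjacent complementary triangles $\Delta_1,\Delta_2$, pick an endpoint $z$ of $f$ and a horocycle $C$ based at $h(z)$, oriented as the boundary of its horoball; let $\delta_j$ be the length of the arc of $C$ inside $h(\Delta_j)$, labelled so that $h(\Delta_2)$ comes before $h(\Delta_1)$ along $C$. Then $s_h(f)=\log(\delta_1/\delta_2)$ (independent of choices). A fan with tip $p$ (a vertex of $\mathcal{F}$) is the set $\mathcal{F}^p$ of all edges of $\mathcal{F}$ having $p$ as an endpoint, indexed $\{f_n^p\}_{n\in\mathbb{Z}}$ so that, on a horocycle $C_p$ at $p$ oriented as the boundary of its horoball, $f_n^p\cap C_p$ comes before $f_{n+1}^p\cap C_p$. Cross-ratio: $\mathrm{cr}(a,b,c,d)=\frac{(c-b)(d-a)}{(b-a)(d-c)}$. An orientation preserving homeomorphism $h:S^1\to S^1$ is $M$-quasisymmetric if $1/M\leq \mathrm{cr}(h(a),h(b),h(c),h(d))\leq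 M$ for all counterclockwise ordered $a,b,c,d\in S^1$ with $\mathrm{cr}(a,b,c,d)=1$; quasisymmetric if $M$-quasisymmetric for some $M$. *)

(* Defs.v *)
From Stdlib Require Import Reals ZArith.
From Coquelicot Require Import Coquelicot.

Local Open Scope R_scope.

Definition on_S1 (z : C) : Prop := Cmod z = 1.

(** Counterclockwise order of three points on S^1: the Euclidean triangle
    (a,b,c) is positively oriented. *)
Definition ccw3 (a b c : C) : Prop :=
  0 < Im (Cmult (Cconj (Cminus b a)) (Cminus c a)).

Definition ccw4 (a b c d : C) : Prop :=
  ccw3 a b c /\ ccw3 b c d /\ ccw3 c d a /\ ccw3 d a b.

Definition cr (a b c d : C) : C :=
  Cdiv (Cmult (Cminus c b) (Cminus d a)) (Cmult (Cminus b a) (Cminus d c)).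

(** Reflection of the ideal point c in the geodesic with ideal endpoints a,b,
    restricted to S^1: the harmonic conjugate of c with respect to a,b. *)
Definition refl_geod (a b c : C) : C :=
  Cdiv (Cminus (Cmult c (Cplus a b)) (Cmult (RtoC 2) (Cmult a b)))
       (Cminus (Cmult (RtoC 2) c) (Cplus a b)).

(** Complementary triangles of the Farey tesselation, as counterclockwise
    ordered triples of ideal vertices: start from Delta_0 = (1, i, -1), and
    repeatedly reflect in sides (rotation just relabels the same triangle). *)
Inductive farey_tri : C -> C -> C -> Prop :=
| farey_tri0 : farey_tri (RtoC 1) Ci (RtoC (-1))
| farey_tri_rot : forall a b c, farey_tri a b c -> farey_tri b c a
| farey_tri_refl : forall a b c, farey_tri a b c -> farey_tri b a (refl_geod a b c).

(** A geodesic identified with its (unordered) pair of ideal endpoints. *)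
Definition geod (a b : C) : C -> Prop := fun z => z = a \/ z = b.

Definition farey_edge (E : C -> Prop) : Prop :=
  exists a b c, farey_tri a b c /\ (forall z, E z <-> geod a b z).

Definition farey_vertex (p : C) : Prop :=
  exists a b c, farey_tri a b c /\ (p = a \/ p = b \/ p = c).

(** Orientation preserving homeomorphisms of S^1 (h : C -> C, only values on
    S^1 matter). *)
Definition cont_on_S1 (h : C -> C) : Prop :=
  forall z, on_S1 z -> filterlim h (within on_S1 (locally z)) (locally (h z)).

Definition homeo_S1 (h : C -> C) : Prop :=
  exists g : C -> C,
    (forall z, on_S1 z ->
       on_S1 (h z) /\ on_S1 (g z) /\ g (h z) = z /\ h (g z) = z)
    /\ cont_on_S1 h /\ cont_on_S1 g.

Definition orient_pres (h : C -> C) : Prop :=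
  forall a b c, on_S1 a -> on_S1 b -> on_S1 c -> ccw3 a b c ->
    ccw3 (h a) (h b) (h c).

Definition fixes_1_i_m1 (h : C -> C) : Prop :=
  h (RtoC 1) = RtoC 1 /\ h Ci = Ci /\ h (RtoC (-1)) = RtoC (-1).

(** M-quasisymmetric (the cross-ratio of points on S^1 is real; we take
    its real part). *)
Definition M_quasisymmetric (M : R) (h : C -> C) : Prop :=
  homeo_S1 h /\ orient_pres h /\
  forall a b c d, on_S1 a -> on_S1 b -> on_S1 c -> on_S1 d ->
    ccw4 a b c d -> cr a b c d = RtoC 1 ->
    / M <= Re (cr (h a) (h b) (h c) (h d)) <= M.

Definition quasisymmetric (h : C -> C) : Prop :=
  exists M, M_quasisymmetric M h.

(** Shear of h on the edge {a,b}, where (a,b,c) and (b,a,d) are the two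
    adjacent complementary triangles (ccw).  Using the horocycle at h(a):
    after an orientation preserving Moebius map sending h(a) to infinity,
    the horocycle is a horizontal line oriented left-to-right, h(Delta_2) =
    h(b,a,d) comes first, and delta_1/delta_2 = (X(hc)-X(hb))/(X(hb)-X(hd)),
    which is the Moebius invariant below. *)
Definition shear (h : C -> C) (a b c d : C) : R :=
  let A := h a in let B := h b in let Cc := h c in let D := h d in
  ln (Re (Cdiv (Cmult (Cminus Cc B) (Cminus D A))
               (Cmult (Cminus B D) (Cminus Cc A)))).

Definition is_shear_of (h : C -> C) (s : (C -> Prop) -> R) : Prop :=
  forall a b c d, farey_tri a b c -> farey_tri b a d ->
    s (geod a b) = shear h a b c d.

(** A fan with tip p, indexed f_n^p = geod p (q n), n in Z, ordered along a
    horocycle at p oriented as boundary of its horoball (equivalently the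
    other endpoints q n move counterclockwise starting from p). *)
Definition is_fan (p : C) (q : Z -> C) : Prop :=
  farey_vertex p /\
  (forall n, farey_edge (geod p (q n))) /\
  (forall E, farey_edge E -> E p -> exists n, forall z, E z <-> geod p (q n) z) /\
  (forall n, ccw3 p (q n) (q (n + 1)%Z)).

Fixpoint psum (g : nat -> R) (n : nat) : R :=
  match n with
  | O => 0
  | S n' => psum g n' + g n'
  end.

Definition fan_ratio (s : (C -> Prop) -> R) (p : C) (q : Z -> C) (m : Z) (k : nat) : R :=
  let f := fun n : Z => s (geod p (q n)) in
  exp (f m) *
  psum (fun j => exp (psum (fun i => f (m + Z.of_nat i + 1)%Z) j)) (S k) /
  psum (fun j => exp (- psum (fun i => f (m - Z.of_nat i - 1)%Z) j)) (S k).

(* Main.v *)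
(** The point [pt (x, y) = (x + iy) / (x - iy)] of the circle has slope [y / x]; it turns 1, i, -1 into
    the slopes 0, 1, infinity, cross-ratios into ratios of 2x2 determinants and the Farey triangles into
    the matrices of SL2(Z).  A fan is then [n |-> w + n v] for an integral basis [(w, v)], and its
    horocyclic lengths are the increments at the integers of [h] read in a coordinate with the tip at infinity;
    the fan ratio is the cross-ratio of the [h]-image of a harmonic quadruple.

    Conversely, [s] is realized by developing the image triangulation along the Stern-Brocot levels.
    For the resulting increasing [h], a harmonic quadruple corresponds to a unimodular binary
    quadratic form; by Hermite reduction some Farey vertex [v] is at bounded distance from its center, so
    that, in the fan line at [v], all its finite gaps have length at least 1/3.  At such scales the fan
    condition at [v], together with boundedly many Stern-Brocot subdivisions inside a unit interval,
    makes [h] doubling, which bounds the image cross-ratio.  The bound on symmetric triples excludes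
    jumps, so [h] is a homeomorphism. *)

Require Import Defs.
From Stdlib Require Import Reals ZArith.
From Coquelicot Require Import Coquelicot.
From Stdlib Require Import Lra Lia Psatz.
From Stdlib Require Import FunctionalExtensionality PropExtensionality IndefiniteDescription.

Local Open Scope R_scope.

(** The obstacle is scale. In one fan line the hypothesis compares only blocks between integers,
    whereas quasisymmetry concerns quadruples of every size and position, and no single cusp sees
    all of them. For a lift [(al, ga)] of determinant 1 the form [det al v ^ 2 + det ga v ^ 2]
    measures how far the horoball at [v] is from the centre of the quadruple, and the gaps in the
    fan line at [v] are reciprocals of products of the numbers [det _ v]; a bound 2 on the form
    bounds these products by 3. Since the cusp changes with the quadruple, all constants must depend
    on [M] alone, which is why they are chosen before the function [Y]. A second danger is
    circularity: the developed map is only known to be increasing, and its continuity is to be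
    deduced from the cross-ratio bound. The bound is therefore proved for every [circle_map], which
    asks only that the circle be mapped to itself with its cyclic order preserved. *)

Ltac field_pos := field; repeat split; trivial; lra.

(** * Points of the circle as directions in the plane *)

Definition vec := (R * R)%type.
Definition det (u v : vec) : R := fst u * snd v - snd u * fst v.
Definition comb (x : R) (u : vec) (y : R) (v : vec) : vec :=
  (x * fst u + y * fst v, x * snd u + y * snd v).
Definition normsq (u : vec) : R := fst u * fst u + snd u * snd u.
Definition pt (u : vec) : C :=
  ((fst u * fst u - snd u * snd u) / normsq u, 2 * fst u * snd u / normsq u).

Lemma normsq_pos (u v : vec) : det u v <> 0 -> 0 < normsq u.
Proof.
  unfold det, normsq; intros H.
  destruct (Req_dec (fst u) 0) as [E|E]; [|nra].
  destruct (Req_dec (snd u) 0) as [F|F]; [|nra].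
  exfalso; apply H; rewrite E, F; ring.
Qed.

Lemma det_antisym (u v : vec) : det v u = - det u v.
Proof. unfold det; ring. Qed.

Lemma det_comb_l (x y : R) (u v z : vec) : det (comb x u y v) z = x * det u z + y * det v z.
Proof. unfold det, comb; simpl; ring. Qed.

Lemma det_comb_r (x y : R) (u v z : vec) : det z (comb x u y v) = x * det z u + y * det z v.
Proof. unfold det, comb; simpl; ring. Qed.

Lemma det_self (u : vec) : det u u = 0.
Proof. unfold det; ring. Qed.

Lemma pt_on_S1 (u : vec) : 0 < normsq u -> on_S1 (pt u).
Proof.
  intros H. unfold on_S1, Cmod. rewrite <- sqrt_1. f_equal.
  unfold pt, normsq in *; simpl; field_pos.
Qed.

Lemma S1_sqr (z : C) : on_S1 z -> fst z * fst z + snd z * snd z = 1.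
Proof.
  unfold on_S1, Cmod; intros H.
  assert (H0 : 0 <= fst z ^ 2 + snd z ^ 2) by nra.
  pose proof (sqrt_sqrt _ H0) as K. rewrite H in K. lra.
Qed.

Lemma pt_surj (z : C) : on_S1 z -> exists u, 0 < normsq u /\ z = pt u.
Proof.
  intros H; apply S1_sqr in H. destruct z as [x y]; simpl in *.
  destruct (Req_dec x (-1)) as [->|E].
  - exists (0, 1); unfold normsq, pt; simpl; split; [lra|].
    assert (y = 0) by nra; subst y. unfold normsq; simpl. apply injective_projections; simpl; field.
  - exists (1 + x, y). assert (0 < normsq (1 + x, y)) by (unfold normsq; simpl; nra).
    split; [assumption|]. unfold pt, normsq in *; simpl in *.
    assert (K : (1 + x) * (1 + x) + y * y = 2 * (1 + x)) by nra. rewrite K in *.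
    apply injective_projections; simpl.
    + replace ((1 + x) * (1 + x) - y * y) with (2 * x * (1 + x)) by nra. field; lra.
    + field; lra.
Qed.

(** Since [pt] doubles angles, the chord from [pt u] to [pt v] has length twice the absolute sine of
    the angle between [u] and [v]. *)
Lemma pt_eq_det (u v : vec) : 0 < normsq u -> 0 < normsq v -> (pt u = pt v <-> det u v = 0).
Proof.
  intros Hu Hv.
  assert (K : (fst (pt u) - fst (pt v)) ^ 2 + (snd (pt u) - snd (pt v)) ^ 2
              = 4 * (det u v) ^ 2 / (normsq u * normsq v)).
  { unfold pt, det, normsq in *; simpl; field_pos. }
  split; intros H.
  - rewrite H in K. assert (4 * det u v ^ 2 / (normsq u * normsq v) = 0) by nra.
    assert (P : 0 < normsq u * normsq v) by nra.
    apply (f_equal (fun t => t * (normsq u * normsq v))) in H0. field_simplify in H0; [|lra]. nra.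
  - rewrite H in K. replace (4 * 0 ^ 2 / (normsq u * normsq v)) with 0 in K by field_pos.
  assert (Z : forall x y, x ^ 2 + y ^ 2 = 0 -> x = 0 /\ y = 0) by (intros; split; nra).
    apply Z in K. destruct K. apply injective_projections; lra.
Qed.

(** The product is quadratic in each vector, so its sign does not depend on the lifts. It is
    negative for [(1, 0)], [(1, 1)], [(0, 1)], the lifts of 1, i, -1. *)
Lemma ccw3_pt (a b c : vec) : 0 < normsq a -> 0 < normsq b -> 0 < normsq c ->
  (ccw3 (pt a) (pt b) (pt c) <-> det a b * det b c * det c a < 0).
Proof.
  intros Ha Hb Hc. unfold ccw3.
  replace (Im _) with (- (4 * (det a b * det b c * det c a) * / (normsq a * normsq b * normsq c))).
  2:{ unfold pt, det, normsq in *; unfold Cmult, Cconj, Cminus, Cplus, Copp, Im; simpl; field_pos. }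
  assert (P : 0 < / (normsq a * normsq b * normsq c)).
  { apply Rinv_0_lt_compat. assert (0 < normsq a * normsq b) by nra. nra. }
  split; intros H; nra.
Qed.

Lemma ccw3_neq (a b c : C) : ccw3 a b c -> a <> b /\ b <> c /\ c <> a.
Proof.
  unfold ccw3, Cmult, Cconj, Cminus, Cplus, Copp, Im; intros H.
  repeat split; intros ->; simpl in H; lra.
Qed.

Lemma ccw3_rot (a b c : C) : ccw3 a b c -> ccw3 b c a.
Proof.
  unfold ccw3, Cmult, Cconj, Cminus, Cplus, Copp, Im; simpl; lra.
Qed.

(* [coord A] is the real coordinate [i (A + z) / (A - z)] of the circle with [A] at infinity. *)
Definition coord (A z : C) : R :=
  (snd A * fst z - fst A * snd z) / (1 - fst A * fst z - snd A * snd z).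

Lemma coord_pt (a u : vec) : det u a <> 0 ->
  coord (pt a) (pt u) = (fst u * fst a + snd u * snd a) / det u a.
Proof.
  intros H. pose proof (normsq_pos _ _ H) as Hu.
  assert (Ha : det a u <> 0) by (rewrite det_antisym; lra). apply normsq_pos in Ha.
  unfold coord.
  assert (E : 1 - fst (pt a) * fst (pt u) - snd (pt a) * snd (pt u) = 2 * det u a ^ 2 / (normsq u * normsq a)).
  { unfold pt, normsq, det in *; simpl; field_pos. }
  assert (F : snd (pt a) * fst (pt u) - fst (pt a) * snd (pt u)
              = 2 * det u a * (fst u * fst a + snd u * snd a) / (normsq u * normsq a)).
  { unfold pt, normsq, det in *; simpl; field_pos. }
  rewrite E, F. field_pos.
Qed.

(** Differences of coordinates are determinants up to factors that each involve one point besides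
    [a]. Such factors cancel in projective invariants, so cross-ratios and shears keep their form in
    every coordinate. *)
Lemma coord_sub (a u v : vec) : det u a <> 0 -> det v a <> 0 ->
  coord (pt a) (pt v) - coord (pt a) (pt u) = normsq a * det u v / (det u a * det v a).
Proof.
  intros H1 H2. rewrite !coord_pt; trivial. unfold det, normsq in *. field. split; assumption.
Qed.

Ltac S1pt z u Hu :=
  match goal with H : on_S1 z |- _ => let E := fresh in destruct (pt_surj z H) as [u [Hu E]]; clear H; subst z end.

Lemma ccw3_coord (A b c : C) : on_S1 A -> on_S1 b -> on_S1 c -> b <> A -> c <> A ->
  (ccw3 A b c <-> coord A b < coord A c).
Proof.
  intros HA Hz Hz' N N'. S1pt A a Ha. S1pt b u Hu. S1pt c v Hv.
  rewrite pt_eq_det in N, N' by trivial.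
  rewrite ccw3_pt by trivial.
  pose proof (coord_sub a u v N N') as K.
  rewrite (det_antisym u a).
  set (x := det u a) in *; set (y := det v a) in *; set (d := det u v) in *.
  assert (P : 0 < x * x * (y * y)) by (assert (0 < x * x) by nra; assert (0 < y * y) by nra; nra).
  assert (K2 : (coord (pt a) (pt v) - coord (pt a) (pt u)) * (x * x * (y * y)) = normsq a * (d * x * y)).
  { rewrite K. field. split; assumption. }
  split; intros H.
  - assert (0 < normsq a * (d * x * y)) by nra.
    apply Rlt_0_minus. nra.
  - assert (0 < (coord (pt a) (pt v) - coord (pt a) (pt u)) * (x * x * (y * y))) by nra.
    rewrite K2 in H0. assert (0 < d * x * y) by nra. nra.
Qed.

(** * Cross-ratios and shears as quotients of determinants and of coordinate differences *)

Definition shear_ratio (a b c d : C) : R :=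
  Re (Cdiv (Cmult (Cminus c b) (Cminus d a)) (Cmult (Cminus b d) (Cminus c a))).

Lemma conj_neq0 (u : vec) : 0 < normsq u -> (fst u, - snd u) <> RtoC 0.
Proof. intros Hu E. injection E; intros E1 E2. unfold normsq in Hu. nra. Qed.

(** A vector is also read as a complex number, [vec] and [C] being the same type. In this form
    circle identities become rational identities in vectors and conjugates, within reach of
    [field]. *)
Lemma pt_conj (u : vec) : 0 < normsq u -> pt u = Cdiv u (fst u, - snd u).
Proof.
  intros Hu. unfold Cdiv, Cinv, pt, Cmult; simpl.
  unfold normsq in *. apply injective_projections; simpl; field_pos.
Qed.

Lemma cross_conj (u v : vec) :
  Cminus (Cmult v (fst u, - snd u)) (Cmult u (fst v, - snd v)) = Cmult (RtoC (det u v)) (0, 2).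
Proof. apply injective_projections; unfold det, Cminus, Cplus, Copp, Cmult, RtoC; simpl; ring. Qed.

Lemma pt_sub_conj (u v : vec) : 0 < normsq u -> 0 < normsq v ->
  Cminus (pt v) (pt u) = Cdiv (Cmult (RtoC (det u v)) (0, 2)) (Cmult (fst u, - snd u) (fst v, - snd v)).
Proof.
  intros Hu Hv. rewrite !pt_conj, <- cross_conj by trivial.
  pose proof (conj_neq0 _ Hu); pose proof (conj_neq0 _ Hv).
  field. split; trivial.
Qed.

Lemma RtoC_neq0 (x : R) : x <> 0 -> RtoC x <> RtoC 0.
Proof. intros H E. injection E. exact H. Qed.

Lemma cr_pt (a b c d : vec) : 0 < normsq a -> 0 < normsq b -> 0 < normsq c -> 0 < normsq d ->
  det a b <> 0 -> det c d <> 0 ->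
  cr (pt a) (pt b) (pt c) (pt d) = RtoC (det b c * det a d / (det a b * det c d)).
Proof.
  intros Ha Hb Hc Hd H1 H2. unfold cr. rewrite !pt_sub_conj by trivial.
  rewrite RtoC_div by (apply Rmult_integral_contrapositive_currified; trivial). rewrite !RtoC_mult.
  pose proof (RtoC_neq0 _ H1); pose proof (RtoC_neq0 _ H2).
  pose proof (conj_neq0 _ Ha); pose proof (conj_neq0 _ Hb); pose proof (conj_neq0 _ Hc); pose proof (conj_neq0 _ Hd).
  assert ((0, 2) <> RtoC 0) by (intros E; injection E; lra).
  field; repeat split; trivial.
Qed.

Lemma shear_ratio_pt (a b c d : vec) : 0 < normsq a -> 0 < normsq b -> 0 < normsq c -> 0 < normsq d ->
  det d b <> 0 -> det a c <> 0 ->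
  shear_ratio (pt a) (pt b) (pt c) (pt d) = det b c * det a d / (det d b * det a c).
Proof.
  intros Ha Hb Hc Hd H1 H2. unfold shear_ratio. rewrite !pt_sub_conj by trivial.
  pose proof (RtoC_neq0 _ H1); pose proof (RtoC_neq0 _ H2).
  pose proof (conj_neq0 _ Ha); pose proof (conj_neq0 _ Hb); pose proof (conj_neq0 _ Hc); pose proof (conj_neq0 _ Hd).
  assert ((0, 2) <> RtoC 0) by (intros E; injection E; lra).
  transitivity (Re (RtoC (det b c * det a d / (det d b * det a c)))); [|reflexivity].
  f_equal. rewrite RtoC_div by (apply Rmult_integral_contrapositive_currified; trivial). rewrite !RtoC_mult.
  field; repeat split; trivial.
Qed.

Ltac S1pts := repeat match goal with H : on_S1 ?z |- _ =>
   let u := fresh "u" in let Hu := fresh "Hu" in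
   let E := fresh in destruct (pt_surj z H) as [u [Hu E]]; clear H; subst z end;
   repeat match goal with H : pt _ <> pt _ |- _ => rewrite pt_eq_det in H by trivial end.
Ltac coord_subs := repeat match goal with |- context [coord (pt ?a) (pt ?v) - coord (pt ?a) (pt ?u)] =>
   rewrite (coord_sub a u v) by trivial end.

Lemma cr_coord (e a b c d : C) : on_S1 e -> on_S1 a -> on_S1 b -> on_S1 c -> on_S1 d ->
  a <> e -> b <> e -> c <> e -> d <> e -> a <> b -> c <> d ->
  Re (cr a b c d) = (coord e c - coord e b) * (coord e d - coord e a)
                    / ((coord e b - coord e a) * (coord e d - coord e c)).
Proof.
  intros. S1pts. rewrite cr_pt by trivial. coord_subs. unfold RtoC, Re; simpl.
  field. repeat split; trivial; lra.
Qed.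

(** The point sent to infinity is now one of the four: the two infinite differences cancel up to
    sign. The other variants of this kind hold for the same reason. *)
Lemma cr_coord_fst (a b c d : C) : on_S1 a -> on_S1 b -> on_S1 c -> on_S1 d ->
  b <> a -> c <> a -> d <> a -> c <> d ->
  Re (cr a b c d) = (coord a c - coord a b) / (coord a d - coord a c).
Proof.
  intros Sa Sb Sc Sd N1 N2 N3 N4. S1pt a u Hu. S1pt b v Hv. S1pt c w Hw. S1pt d z Hz. S1pts.
  assert (K : forall u v, det u v <> 0 -> det v u <> 0) by (intros; rewrite det_antisym; lra).
  rewrite cr_pt by auto. coord_subs. unfold RtoC, Re; simpl.
  rewrite (det_antisym v u), (det_antisym z u).
  field. repeat split; trivial; lra.
Qed.

Lemma cr_coord_snd (a b c d : C) : on_S1 a -> on_S1 b -> on_S1 c -> on_S1 d ->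
  a <> b -> c <> b -> d <> b -> c <> d ->
  Re (cr a b c d) = (coord b a - coord b d) / (coord b d - coord b c).
Proof.
  intros Sa Sb Sc Sd N1 N2 N3 N4. S1pt a u Hu. S1pt b v Hv. S1pt c w Hw. S1pt d z Hz. S1pts.
  assert (K : forall u v, det u v <> 0 -> det v u <> 0) by (intros; rewrite det_antisym; lra).
  rewrite cr_pt by auto. coord_subs. unfold RtoC, Re; simpl.
  rewrite (det_antisym w v), (det_antisym z u).
  field. repeat split; trivial; lra.
Qed.

Lemma cr_rot (a b c d : C) : on_S1 a -> on_S1 b -> on_S1 c -> on_S1 d ->
  a <> b -> b <> c -> c <> d -> d <> a -> cr b c d a = RtoC (/ Re (cr a b c d)).
Proof.
  intros Sa Sb Sc Sd N1 N2 N3 N4. S1pt a u Hu. S1pt b v Hv. S1pt c w Hw. S1pt d z Hz. S1pts.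
  rewrite !cr_pt by auto. unfold Re; simpl. f_equal.
  assert (det u z <> 0) by (rewrite det_antisym; lra).
  rewrite (det_antisym u v), (det_antisym u z).
  field. repeat split; trivial; lra.
Qed.

Lemma cr_rot2 (a b c d : C) : cr c d a b = cr a b c d.
Proof.
  unfold cr.
  replace (Cmult (Cminus a d) (Cminus b c)) with (Cmult (Cminus c b) (Cminus d a)) by ring.
  replace (Cmult (Cminus d c) (Cminus b a)) with (Cmult (Cminus b a) (Cminus d c)) by ring.
  reflexivity.
Qed.

Lemma shear_coord (e a b c d : C) : on_S1 e -> on_S1 a -> on_S1 b -> on_S1 c -> on_S1 d ->
  a <> e -> b <> e -> c <> e -> d <> e -> b <> d -> c <> a ->
  shear_ratio a b c d = (coord e c - coord e b) * (coord e d - coord e a)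
                    / ((coord e b - coord e d) * (coord e c - coord e a)).
Proof.
  intros Se Sa Sb Sc Sd N0 N1 N2 N3 N4 N5.
  S1pt e x Hx. S1pt a u Hu. S1pt b v Hv. S1pt c w Hw. S1pt d z Hz. S1pts.
  assert (K : forall u v, det u v <> 0 -> det v u <> 0) by (intros; rewrite det_antisym; lra).
  rewrite shear_ratio_pt by auto. coord_subs.
  assert (det u w <> 0) by auto. assert (det z v <> 0) by auto.
  field. repeat split; trivial; lra.
Qed.

Lemma shear_coord_fst (a b c d : C) : on_S1 a -> on_S1 b -> on_S1 c -> on_S1 d ->
  b <> a -> c <> a -> d <> a -> b <> d ->
  shear_ratio a b c d = (coord a c - coord a b) / (coord a b - coord a d).
Proof.
  intros Sa Sb Sc Sd N1 N2 N3 N4. S1pt a u Hu. S1pt b v Hv. S1pt c w Hw. S1pt d z Hz. S1pts.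
  assert (K : forall u v, det u v <> 0 -> det v u <> 0) by (intros; rewrite det_antisym; lra).
  rewrite shear_ratio_pt by auto. coord_subs. assert (det z v <> 0) by auto.
  rewrite (det_antisym w u), (det_antisym z u).
  field. repeat split; trivial; lra.
Qed.

Lemma shear_coord_thd (a b c d : C) : on_S1 a -> on_S1 b -> on_S1 c -> on_S1 d ->
  a <> c -> b <> c -> d <> c -> b <> d ->
  shear_ratio a b c d = (coord c d - coord c a) / (coord c b - coord c d).
Proof.
  intros Sa Sb Sc Sd N1 N2 N3 N4. S1pt a u Hu. S1pt b v Hv. S1pt c w Hw. S1pt d z Hz. S1pts.
  assert (K : forall u v, det u v <> 0 -> det v u <> 0) by (intros; rewrite det_antisym; lra).
  rewrite shear_ratio_pt by auto. coord_subs. assert (det z v <> 0) by auto.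
  field. repeat split; trivial; lra.
Qed.

(** * Farey triangles and fans *)

Definition zvec (a : Z * Z) : vec := (IZR (fst a), IZR (snd a)).
Definition zdet (a b : Z * Z) : Z := (fst a * snd b - snd a * fst b)%Z.
Definition zcomb (x : Z) (a : Z * Z) (y : Z) (b : Z * Z) : Z * Z :=
  (x * fst a + y * fst b, x * snd a + y * snd b)%Z.
Definition zpt (a : Z * Z) : C := pt (zvec a).

Lemma det_zvec (a b : Z * Z) : det (zvec a) (zvec b) = IZR (zdet a b).
Proof. unfold det, zdet, zvec; simpl. rewrite minus_IZR, !mult_IZR. ring. Qed.

Lemma zvec_zcomb (x y : Z) (a b : Z * Z) :
  zvec (zcomb x a y b) = comb (IZR x) (zvec a) (IZR y) (zvec b).
Proof. unfold zvec, zcomb, comb; simpl. rewrite !plus_IZR, !mult_IZR. reflexivity. Qed.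

Lemma zdet_antisym (a b : Z * Z) : zdet b a = (- zdet a b)%Z.
Proof. unfold zdet; ring. Qed.

Lemma zdet_zcomb_l (x y : Z) (u v z : Z * Z) :
  zdet (zcomb x u y v) z = (x * zdet u z + y * zdet v z)%Z.
Proof. unfold zdet, zcomb; simpl; ring. Qed.

Lemma zdet_zcomb_r (x y : Z) (u v z : Z * Z) :
  zdet z (zcomb x u y v) = (x * zdet z u + y * zdet z v)%Z.
Proof. unfold zdet, zcomb; simpl; ring. Qed.

Lemma zdet_self (u : Z * Z) : zdet u u = 0%Z.
Proof. unfold zdet; ring. Qed.

Lemma zvec_pos (a b : Z * Z) : zdet a b <> 0%Z -> 0 < normsq (zvec a) /\ 0 < normsq (zvec b).
Proof.
  intros H. apply eq_IZR_contrapositive in H. rewrite <- det_zvec in H.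
  split; [apply (normsq_pos _ _ H)|]. apply (normsq_pos _ (zvec a)). rewrite det_antisym. lra.
Qed.

Lemma zpt_eq (a b : Z * Z) : 0 < normsq (zvec a) -> 0 < normsq (zvec b) ->
  (zpt a = zpt b <-> zdet a b = 0%Z).
Proof.
  intros Ha Hb. unfold zpt. rewrite pt_eq_det, det_zvec by trivial.
  split; [apply eq_IZR | intros ->; reflexivity].
Qed.

Definition zopp (a : Z * Z) : Z * Z := (- fst a, - snd a)%Z.

Lemma zpt_opp (a : Z * Z) : zpt (zopp a) = zpt a.
Proof.
  unfold zpt, zopp, zvec, pt, normsq; simpl. rewrite !opp_IZR.
  f_equal; f_equal; try ring; f_equal; ring.
Qed.

(** With respect to [u] and [v] the directions [v - u] and [v + u] are harmonic conjugates, so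
    reflecting a triangle amounts to an integral change of basis. *)
Lemma refl_geod_pt (u v : vec) : det u v <> 0 ->
  refl_geod (pt u) (pt v) (pt (comb (-1) u 1 v)) = pt (comb 1 u 1 v).
Proof.
  intros H.
  pose proof (normsq_pos _ _ H) as Hu.
  assert (Hv : 0 < normsq v) by (apply (normsq_pos _ u); rewrite det_antisym; lra).
  assert (Hm : 0 < normsq (comb (-1) u 1 v))
    by (apply (normsq_pos _ u); rewrite det_comb_l, det_self, det_antisym; lra).
  assert (Hp : 0 < normsq (comb 1 u 1 v))
    by (apply (normsq_pos _ u); rewrite det_comb_l, det_self, det_antisym; lra).
  rewrite !pt_conj by trivial.
  pose proof (conj_neq0 _ Hu) as Nu; pose proof (conj_neq0 _ Hv) as Nv.
  pose proof (conj_neq0 _ Hm) as Nm; pose proof (conj_neq0 _ Hp) as Np.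
  pose proof (cross_conj u v) as K.
  replace (fst (comb (-1) u 1 v), - snd (comb (-1) u 1 v)) with
    (Cminus (fst v, - snd v) (fst u, - snd u)) in *
    by (apply injective_projections; unfold comb, Cminus, Cplus, Copp; simpl; ring).
  replace (fst (comb 1 u 1 v), - snd (comb 1 u 1 v)) with
    (Cplus (fst v, - snd v) (fst u, - snd u)) in *
    by (apply injective_projections; unfold comb, Cminus, Cplus, Copp; simpl; ring).
  replace (comb (-1) u 1 v) with (Cminus v u)
    by (apply injective_projections; unfold comb, Cminus, Cplus, Copp; simpl; ring).
  replace (comb 1 u 1 v) with (Cplus v u)
    by (apply injective_projections; unfold comb, Cminus, Cplus, Copp; simpl; ring).
  assert (N2 : Cmult (RtoC (det u v)) (0, 2) <> RtoC 0).
  { apply Cmult_neq_0; [apply RtoC_neq0; trivial|]. intros E; injection E; lra. }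
  rewrite <- K in N2. clear K.
  (* From here on the conjugates are variables independent of [u] and [v]; only nonvanishing
     conditions are kept. *)
  set (U' := (fst u, - snd u) : C) in *; set (V' := (fst v, - snd v) : C) in *.
  clearbody U' V'. unfold refl_geod.
  replace (Cminus (Cmult (RtoC 2) (Cdiv (Cminus v u) (Cminus V' U'))) (Cplus (Cdiv u U') (Cdiv v V')))
    with (Cdiv (Cmult (Cminus (Cmult v U') (Cmult u V')) (Cplus V' U')) (Cmult (Cmult U' V') (Cminus V' U')))
    by (field; repeat split; trivial).
  replace (Cminus (Cmult (Cdiv (Cminus v u) (Cminus V' U')) (Cplus (Cdiv u U') (Cdiv v V'))) (Cmult (RtoC 2) (Cmult (Cdiv u U') (Cdiv v V'))))
    with (Cdiv (Cmult (Cminus (Cmult v U') (Cmult u V')) (Cplus v u)) (Cmult (Cmult U' V') (Cminus V' U')))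
    by (field; repeat split; trivial).
  field; repeat split; trivial.
Qed.

Lemma zpt_1 : zpt (1, 0)%Z = RtoC 1.
Proof. unfold zpt, zvec, pt, normsq; apply injective_projections; simpl; field. Qed.
Lemma zpt_i : zpt (1, 1)%Z = Ci.
Proof. unfold zpt, zvec, pt, normsq; apply injective_projections; simpl; field. Qed.
Lemma zpt_m1 : zpt (0, 1)%Z = RtoC (-1).
Proof. unfold zpt, zvec, pt, normsq; apply injective_projections; simpl; field. Qed.

(** A triangle is recorded as an integral basis of determinant 1 whose difference is the third
    vertex. A rotation turns the basis [(v, w)] into [(w, w - v)], a reflection turns it into
    [(w, -v)]. *)
Lemma farey_tri_vec (a b c : C) : farey_tri a b c ->
  exists v w, zdet v w = 1%Z /\ a = zpt v /\ b = zpt w /\ c = zpt (zcomb (-1) v 1 w).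
Proof.
  induction 1 as [| a b c _ (v & w & D & -> & -> & ->)| a b c _ (v & w & D & -> & -> & ->)].
  - exists (1, 0)%Z, (1, 1)%Z. rewrite <- zpt_1, <- zpt_i, <- zpt_m1. repeat split.
  - exists w, (zcomb (-1) v 1 w). rewrite zdet_zcomb_r, zdet_self, (zdet_antisym v w), D.
    repeat split. rewrite <- zpt_opp. f_equal.
    unfold zopp, zcomb; apply injective_projections; cbn [fst snd]; ring.
  - exists w, (zopp v). rewrite zpt_opp. repeat split.
    + rewrite <- D. unfold zdet, zopp; simpl; ring.
    + unfold zpt. rewrite zvec_zcomb, refl_geod_pt.
      2:{ rewrite det_zvec, D. apply R1_neq_R0. }
      change 1 with (IZR 1). rewrite <- zvec_zcomb. fold (zpt (zcomb 1 v 1 w)).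
      match goal with |- _ = pt (zvec ?z) => fold (zpt z) end.
      rewrite <- zpt_opp. f_equal. unfold zopp, zcomb; apply injective_projections; cbn [fst snd]; ring.
Qed.

Definition vec_tri (v w : Z * Z) : Prop := farey_tri (zpt v) (zpt w) (zpt (zcomb (-1) v 1 w)).

Ltac zvring := unfold zopp, zcomb; apply injective_projections; cbn [fst snd]; ring.

Lemma vec_tri_rot (v w : Z * Z) : vec_tri v w -> vec_tri w (zcomb (-1) v 1 w).
Proof.
  unfold vec_tri; intros H. apply farey_tri_rot in H.
  replace (zpt (zcomb (-1) w 1 (zcomb (-1) v 1 w))) with (zpt v); trivial.
  rewrite <- zpt_opp. f_equal. zvring.
Qed.

Lemma vec_tri_flip (v w : Z * Z) : zdet v w = 1%Z -> vec_tri v w -> vec_tri w (zopp v).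
Proof.
  unfold vec_tri; intros D H. apply farey_tri_refl in H.
  unfold zpt at 3 4 in H. unfold zpt at 3 in H. rewrite zvec_zcomb, refl_geod_pt in H.
  2:{ rewrite det_zvec, D. apply R1_neq_R0. }
  change 1 with (IZR 1) in H. rewrite <- zvec_zcomb in H. fold (zpt (zcomb 1 v 1 w)) in H.
  fold (zpt v) in H. fold (zpt w) in H.
  rewrite zpt_opp. replace (zpt (zcomb (-1) w 1 (zopp v))) with (zpt (zcomb 1 v 1 w)); trivial.
  rewrite <- zpt_opp. f_equal. zvring.
Qed.

Lemma vec_tri_opp (v w : Z * Z) : vec_tri v w -> vec_tri (zopp v) (zopp w).
Proof.
  unfold vec_tri. rewrite !zpt_opp.
  replace (zpt (zcomb (-1) (zopp v) 1 (zopp w))) with (zpt (zcomb (-1) v 1 w)); trivial.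
  rewrite <- zpt_opp. f_equal. zvring.
Qed.

(** A flip, a rotation and a change of sign compose to the parabolic that fixes [v]. Together with
    the flip it supplies the moves of Euclid's algorithm. *)
Lemma vec_tri_shear (v w : Z * Z) : zdet v w = 1%Z -> vec_tri v w -> vec_tri v (zcomb 1 v 1 w).
Proof.
  intros D H. apply (vec_tri_flip _ _ D), vec_tri_rot, vec_tri_opp in H.
  replace v with (zopp (zopp v)) at 1 by zvring.
  replace (zcomb 1 v 1 w) with (zopp (zcomb (-1) w 1 (zopp v))) by zvring. exact H.
Qed.

Lemma vec_tri_shear_inv (v w : Z * Z) : zdet v w = 1%Z -> vec_tri v w -> vec_tri v (zcomb (-1) v 1 w).
Proof.
  intros D H. apply vec_tri_rot, vec_tri_rot, vec_tri_flip, vec_tri_opp in H.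
  2:{ unfold zdet, zcomb in *; cbn [fst snd] in *; lia. }
  replace (zopp (zcomb (-1) w 1 (zcomb (-1) v 1 w))) with v in H by zvring.
  replace (zopp (zopp (zcomb (-1) v 1 w))) with (zcomb (-1) v 1 w) in H by zvring.
  exact H.
Qed.

(* Euclid's algorithm on the first coordinates; a zero first coordinate leaves a power of the parabolic. *)
Lemma vec_tri_all (v w : Z * Z) : zdet v w = 1%Z -> vec_tri v w.
Proof.
  assert (E : forall x u z, zcomb (-1) u 1 (zcomb 1 u x z) = zcomb 0 u x z) by (intros; zvring).
  assert (back : forall v w, zdet v w = 1%Z -> vec_tri v (zcomb 1 v 1 w) -> vec_tri v w).
  { intros u z D H. apply vec_tri_shear_inv in H.
    2:{ unfold zdet, zcomb in *; cbn [fst snd] in *; lia. }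
    rewrite E in H. replace (zcomb 0 u 1 z) with z in H by zvring. exact H. }
  assert (back' : forall v w, zdet v w = 1%Z -> vec_tri v (zcomb (-1) v 1 w) -> vec_tri v w).
  { intros u z D H. apply vec_tri_shear in H.
    2:{ unfold zdet, zcomb in *; cbn [fst snd] in *; lia. }
    replace (zcomb 1 u 1 (zcomb (-1) u 1 z)) with z in H by zvring. exact H. }
  assert (swap : forall v w, zdet v w = 1%Z -> vec_tri w (zopp v) -> vec_tri v w).
  { intros u z D H. apply vec_tri_flip, vec_tri_opp in H.
    2:{ unfold zdet, zopp in *; cbn [fst snd] in *; lia. }
    replace (zopp (zopp u)) with u in H by zvring. replace (zopp (zopp z)) with z in H by zvring. exact H. }
  assert (opp : forall v w, vec_tri (zopp v) (zopp w) -> vec_tri v w).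
  { intros u z H. apply vec_tri_opp in H.
    replace (zopp (zopp u)) with u in H by zvring. replace (zopp (zopp z)) with z in H by zvring. exact H. }
  assert (par : forall n y, (Z.abs y <= Z.of_nat n)%Z -> vec_tri (0, 1)%Z (-1, y)%Z).
  { assert (B : vec_tri (0, 1)%Z (-1, 0)%Z).
    { unfold vec_tri.
      rewrite <- (zpt_opp (-1, 0)%Z), <- (zpt_opp (zcomb _ _ _ _)).
      replace (zopp (-1, 0))%Z with (1, 0)%Z by zvring.
      replace (zopp _) with (1, 1)%Z by zvring.
      rewrite zpt_1, zpt_i, zpt_m1. apply farey_tri_rot, farey_tri_rot, farey_tri0. }
    induction n as [|n IH]; intros y Hy.
    - replace y with 0%Z by lia. exact B.
    - destruct (Z.lt_trichotomy y 0) as [L|[->|L]]; [| exact B |].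
      + apply back; [unfold zdet; cbn [fst snd]; lia|].
        replace (zcomb 1 (0, 1) 1 (-1, y))%Z with (-1, y + 1)%Z by zvring. apply IH; lia.
      + apply back'; [unfold zdet; cbn [fst snd]; lia|].
        replace (zcomb (-1) (0, 1) 1 (-1, y))%Z with (-1, y - 1)%Z by zvring. apply IH; lia. }
  enough (main : forall n v w, (Z.abs (fst v) + Z.abs (fst w) <= Z.of_nat n)%Z -> zdet v w = 1%Z -> vec_tri v w).
  { intros D. apply (main (Z.to_nat (Z.abs (fst v) + Z.abs (fst w)))); trivial; lia. }
  clear v w. induction n as [n IH] using (well_founded_induction Wf_nat.lt_wf). intros v w Hn D.
  assert (Z0 : forall v w, zdet v w = 1%Z -> fst v = 0%Z -> vec_tri v w).
  { intros [a b] [c d] D0 H0; unfold zdet in D0; cbn [fst snd] in *. subst a.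
    assert (c = -1 /\ b = 1 \/ c = 1 /\ b = -1)%Z as [[-> ->]|[-> ->]].
    { assert (b * (- c) = 1)%Z by lia. apply Z.eq_mul_1 in H. lia. }
    - apply (par (Z.to_nat (Z.abs d))); lia.
    - apply opp. replace (zopp (0, -1))%Z with (0, 1)%Z by zvring.
      replace (zopp (1, d))%Z with (-1, - d)%Z by zvring. apply (par (Z.to_nat (Z.abs d))); lia. }
  destruct (Z.eq_dec (fst v) 0) as [E0|E0]; [apply Z0; trivial|].
  destruct (Z.eq_dec (fst w) 0) as [E1|E1].
  { apply swap; trivial. apply Z0; trivial. unfold zdet, zopp in *; cbn [fst snd] in *; lia. }
  assert (step : forall v w, zdet v w = 1%Z -> fst v <> 0%Z -> (Z.abs (fst v) <= Z.abs (fst w))%Z ->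
     (Z.abs (fst v) + Z.abs (fst w) <= Z.of_nat n)%Z -> vec_tri v w).
  { clear v w Hn D E0 E1. intros v w D N L Hn.
    destruct (Z_le_gt_dec 0 (fst v * fst w)) as [S|S].
    - apply back'; trivial. apply (IH (Z.to_nat (Z.abs (fst v) + Z.abs (fst (zcomb (-1) v 1 w))))).
      + unfold zcomb; cbn [fst snd]. nia.
      + unfold zcomb; cbn [fst snd]. lia.
      + unfold zdet, zcomb in *; cbn [fst snd] in *; lia.
    - apply back; trivial. apply (IH (Z.to_nat (Z.abs (fst v) + Z.abs (fst (zcomb 1 v 1 w))))).
      + unfold zcomb; cbn [fst snd]. nia.
      + unfold zcomb; cbn [fst snd]. lia.
      + unfold zdet, zcomb in *; cbn [fst snd] in *; lia. }
  destruct (Z_le_gt_dec (Z.abs (fst v)) (Z.abs (fst w))) as [L|L].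
  - apply step; trivial.
  - apply swap; trivial. apply step; unfold zdet, zopp in *; cbn [fst snd] in *; lia.
Qed.

Lemma farey_edge_iff (v w : Z * Z) : zdet v w = 1%Z -> farey_edge (geod (zpt v) (zpt w)).
Proof.
  intros D. exists (zpt v), (zpt w), (zpt (zcomb (-1) v 1 w)).
  split; [apply vec_tri_all; trivial|]. tauto.
Qed.

Lemma geod_sym (a b : C) : geod a b = geod b a.
Proof.
  apply functional_extensionality; intros z. apply propositional_extensionality. unfold geod; tauto.
Qed.

Lemma zvec_basis (w v b : Z * Z) : zdet w v = 1%Z -> b = zcomb (zdet b v) w (zdet w b) v.
Proof.
  unfold zdet, zcomb; intros D. apply injective_projections; cbn [fst snd].
  - rewrite <- (Z.mul_1_l (fst b)) at 1. rewrite <- D. ring.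
  - rewrite <- (Z.mul_1_l (snd b)) at 1. rewrite <- D. ring.
Qed.

Lemma fan_pos (w v : Z * Z) (k : Z) : zdet w v = 1%Z ->
  0 < normsq (zvec v) /\ 0 < normsq (zvec (zcomb 1 w k v)).
Proof.
  intros D. apply zvec_pos. rewrite zdet_zcomb_r, zdet_self, (zdet_antisym w v). lia.
Qed.

(** The other end has determinant 1 or -1 with [v], so its [w]-coordinate in the basis [(w, v)] is 1
    or -1, and [zpt] forgets the sign. *)
Lemma edge_at_vertex (E : C -> Prop) (w v : Z * Z) : zdet w v = 1%Z ->
  farey_edge E -> E (zpt v) ->
  exists k, forall z, E z <-> geod (zpt v) (zpt (zcomb 1 w k v)) z.
Proof.
  intros D (a & b & c & T & HE) Hv.
  apply farey_tri_vec in T. destruct T as (a' & b' & D' & -> & -> & _).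
  assert (K : forall a b, (zdet a b = 1 \/ zdet a b = -1)%Z -> zpt v = zpt a -> exists k, zpt b = zpt (zcomb 1 w k v)).
  { clear a' b' D' HE. intros a b D' Ea.
    destruct (zvec_pos w v ltac:(lia)) as [_ Pv]. destruct (zvec_pos a b ltac:(lia)) as [Pa _].
    apply zpt_eq in Ea; trivial.
    pose proof (zvec_basis w v a D) as Ba.
    rewrite (zdet_antisym v a), Ea in Ba.
    assert (Bd : zdet a b = (zdet w a * zdet v b)%Z).
    { rewrite Ba at 1. rewrite zdet_zcomb_l. ring. }
    assert (X : (zdet v b = 1 \/ zdet v b = -1)%Z).
    { destruct D' as [D'|D']; rewrite D' in Bd.
      - symmetry in Bd. rewrite Z.mul_comm in Bd. apply Z.eq_mul_1 in Bd. lia.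
      - assert (Bd' : (zdet v b * - zdet w a = 1)%Z) by lia. apply Z.eq_mul_1 in Bd'. lia. }
    pose proof (zvec_basis w v b D) as Bb. rewrite (zdet_antisym v b) in Bb.
    destruct X as [X|X]; rewrite X in Bb.
    - exists (- zdet w b)%Z. rewrite <- zpt_opp. rewrite Bb at 1. f_equal. zvring.
    - exists (zdet w b)%Z. rewrite Bb at 1. reflexivity. }
  apply HE in Hv as Hv'. destruct Hv' as [Ev|Ev].
  - destruct (K a' b' (or_introl D') Ev) as [k Hk]. exists k. rewrite Ev, <- Hk. exact HE.
  - destruct (K b' a') as [k Hk]; trivial.
    { right. rewrite zdet_antisym. lia. }
    exists k. rewrite Ev, <- Hk. intros z. rewrite HE. unfold geod; tauto.
Qed.

Lemma fan_ccw (w v : Z * Z) (k l : Z) : zdet w v = 1%Z ->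
  (ccw3 (zpt v) (zpt (zcomb 1 w k v)) (zpt (zcomb 1 w l v)) <-> (k < l)%Z).
Proof.
  intros D. destruct (fan_pos w v k D) as [P1 P2]. destruct (fan_pos w v l D) as [_ P3].
  unfold zpt. rewrite ccw3_pt by trivial. rewrite !det_zvec, <- !mult_IZR.
  replace (zdet v (zcomb 1 w k v) * zdet (zcomb 1 w k v) (zcomb 1 w l v) * zdet (zcomb 1 w l v) v)%Z
    with (k - l)%Z.
  - split; intros H; [apply lt_IZR in H | apply IZR_lt]; lia.
  - rewrite !zdet_zcomb_l, !zdet_zcomb_r, !zdet_self, (zdet_antisym w v), D. ring.
Qed.

Lemma vec_is_fan (w v : Z * Z) : zdet w v = 1%Z ->
  is_fan (zpt v) (fun n => zpt (zcomb 1 w n v)).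
Proof.
  intros D.
  assert (Dv : forall n, zdet v (zopp (zcomb 1 w n v)) = 1%Z)
    by (intros n; unfold zdet, zcomb, zopp in *; cbn [fst snd] in *; lia).
  repeat split.
  - exists (zpt v), (zpt (zopp (zcomb 1 w 0 v))), (zpt (zcomb (-1) v 1 (zopp (zcomb 1 w 0 v)))).
    split; [apply vec_tri_all; trivial | tauto].
  - intros n. rewrite <- (zpt_opp (zcomb 1 w n v)). apply farey_edge_iff; trivial.
  - intros E HE Hv. apply edge_at_vertex; trivial.
  - intros n. apply fan_ccw; trivial. lia.
Qed.

Lemma strict_mono_surj_Z (f : Z -> Z) :
  (forall n, (f n < f (n + 1))%Z) -> (forall k, exists n, f n = k) ->
  forall n, f n = (f 0 + n)%Z.
Proof.
  intros M Sj.
  assert (M' : forall d n, (f n + Z.of_nat d <= f (n + Z.of_nat d))%Z).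
  { induction d as [|d IH]; intros n; [replace (n + Z.of_nat 0)%Z with n by lia; lia|].
    specialize (IH n). specialize (M (n + Z.of_nat d)%Z).
    replace (n + Z.of_nat (S d))%Z with (n + Z.of_nat d + 1)%Z by lia. lia. }
  assert (M2 : forall n m, (n <= m)%Z -> (f n + (m - n) <= f m)%Z).
  { intros n m L. specialize (M' (Z.to_nat (m - n)) n).
    rewrite Z2Nat.id in M' by lia. replace (n + (m - n))%Z with m in M' by lia. exact M'. }
  assert (step : forall n, f (n + 1)%Z = (f n + 1)%Z).
  { intros n. destruct (Sj (f n + 1)%Z) as [m Hm].
    destruct (Z_le_gt_dec m n) as [L|L].
    - specialize (M2 _ _ L). lia.
    - assert (L' : (n + 1 <= m)%Z) by lia. specialize (M2 _ _ L'). specialize (M n). lia. }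
  intros n. destruct (Z_le_gt_dec 0 n) as [L|L].
  - rewrite <- (Z2Nat.id n L). induction (Z.to_nat n) as [|d IH]; [simpl; lia|].
    replace (Z.of_nat (S d)) with (Z.of_nat d + 1)%Z by lia. rewrite step. lia.
  - replace n with (- Z.of_nat (Z.to_nat (- n)))%Z by lia. induction (Z.to_nat (- n)) as [|d IH]; [simpl; lia|].
    specialize (step (- Z.of_nat (S d))%Z). replace (- Z.of_nat (S d) + 1)%Z with (- Z.of_nat d)%Z in step by lia. lia.
Qed.

(** The edges at the tip are numbered by the [k] of [edge_at_vertex]. Cyclic order makes the index
    map strictly increasing and exhaustiveness makes it onto, so it is a translation, which is
    absorbed into [w]. *)
Lemma is_fan_vec (p : C) (q : Z -> C) : is_fan p q ->
  exists w v, zdet w v = 1%Z /\ p = zpt v /\ forall n, q n = zpt (zcomb 1 w n v).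
Proof.
  intros ((a & b & c & T & Hp) & HE & HS & HC).
  assert (K : exists w v, zdet w v = 1%Z /\ p = zpt v).
  { destruct Hp as [->|[->| ->]]; [ | apply farey_tri_rot in T | apply farey_tri_rot, farey_tri_rot in T];
    apply farey_tri_vec in T as (v & w & D & -> & _); exists (zopp w), v; split; trivial;
    rewrite <- D; unfold zdet, zopp; cbn [fst snd]; ring. }
  destruct K as (w & v & D & ->).
  assert (inj : forall k r, (forall z, geod (zpt v) r z <-> geod (zpt v) (zpt (zcomb 1 w k v)) z) ->
     r = zpt (zcomb 1 w k v)).
  { intros k r H. destruct (fan_pos w v k D) as [P1 P2].
    assert (N : zpt (zcomb 1 w k v) <> zpt v).
    { intros E. apply zpt_eq in E; trivial. rewrite zdet_zcomb_l, zdet_self, D in E. lia. }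
    specialize (H (zpt (zcomb 1 w k v))). unfold geod in H. destruct H as [_ H].
    destruct H as [H|H]; [tauto | contradiction | symmetry; trivial]. }
  assert (Q : forall n, exists k, q n = zpt (zcomb 1 w k v)).
  { intros n. destruct (edge_at_vertex _ w v D (HE n)) as [k Hk]; [left; reflexivity|].
    exists k. apply inj; trivial. }
  apply functional_choice in Q as [f Hf].
  assert (kinj : forall k l, zpt (zcomb 1 w k v) = zpt (zcomb 1 w l v) -> k = l).
  { intros k l E. destruct (fan_pos w v k D) as [P1 P2]. destruct (fan_pos w v l D) as [_ P3].
    apply zpt_eq in E; trivial.
    rewrite !zdet_zcomb_l, !zdet_zcomb_r, !zdet_self, (zdet_antisym w v), D in E. lia. }
  assert (F : forall n, f n = (f 0 + n)%Z).
  { apply strict_mono_surj_Z.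
    - intros n. specialize (HC n). rewrite !Hf in HC. apply fan_ccw in HC; trivial.
    - intros k. destruct (HS (geod (zpt v) (zpt (zcomb 1 w k v)))) as [n Hn].
      + pose proof (vec_is_fan w v D) as (_ & X & _). exact (X k).
      + left; reflexivity.
      + exists n. apply kinj. rewrite <- Hf. apply inj. intros z. symmetry. apply Hn. }
  exists (zcomb 1 w (f 0%Z) v), v. repeat split; trivial.
  - rewrite zdet_zcomb_l, zdet_self, D. ring.
  - intros n. rewrite Hf, F. f_equal. zvring.
Qed.

(** * Fan ratios *)

Lemma psum_ext (f g : nat -> R) (n : nat) : (forall i, f i = g i) -> psum f n = psum g n.
Proof. intros H; induction n as [|n IH]; simpl; [|rewrite IH, H]; reflexivity. Qed.

(** Each partial product of exponentials of shears is a gap of [x] divided by the gap next to [x m],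
    on the right in the numerator and on the left in the denominator, so both sums telescope. The
    factor in front exchanges the two normalisations. *)
Lemma fan_ratio_telescope (s : (C -> Prop) -> R) (p : C) (q : Z -> C) (x : Z -> R) (m : Z) (k : nat) :
  (forall n, x n < x (n + 1)%Z) ->
  (forall n, s (geod p (q n)) = ln ((x (n + 1)%Z - x n) / (x n - x (n - 1)%Z))) ->
  fan_ratio s p q m k
  = (x (m + Z.of_nat (S k))%Z - x m) / (x m - x (m - Z.of_nat (S k))%Z).
Proof.
  intros Hx Hs. unfold fan_ratio.
  assert (D : forall n, 0 < x (n + 1)%Z - x n) by (intros n; specialize (Hx n); lra).
  assert (D' : forall n, 0 < x n - x (n - 1)%Z).
  { intros n. specialize (D (n - 1)%Z). replace (n - 1 + 1)%Z with n in D by lia. exact D. }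
  assert (Hf : forall n, exp (s (geod p (q n))) = (x (n + 1)%Z - x n) / (x n - x (n - 1)%Z)).
  { intros n. rewrite Hs. apply exp_ln, Rdiv_lt_0_compat; auto. }
  assert (up : forall j, exp (psum (fun i => s (geod p (q (m + Z.of_nat i + 1)%Z))) j)
      = (x (m + Z.of_nat j + 1)%Z - x (m + Z.of_nat j)%Z) / (x (m + 1)%Z - x m)).
  { induction j as [|j IH].
    - simpl. rewrite exp_0. replace (m + 0)%Z with m by lia. specialize (D m). field. lra.
    - simpl psum. rewrite exp_plus, IH, Hf.
      replace (m + Z.of_nat (S j))%Z with (m + Z.of_nat j + 1)%Z by lia.
      replace (m + Z.of_nat j + 1 - 1)%Z with (m + Z.of_nat j)%Z by lia.
      pose proof (D m). pose proof (D (m + Z.of_nat j)%Z). field. lra. }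
  assert (down : forall j, exp (- psum (fun i => s (geod p (q (m - Z.of_nat i - 1)%Z))) j)
      = (x (m - Z.of_nat j)%Z - x (m - Z.of_nat j - 1)%Z) / (x m - x (m - 1)%Z)).
  { induction j as [|j IH].
    - simpl. rewrite Ropp_0, exp_0. replace (m - 0)%Z with m by lia. specialize (D' m). field. lra.
    - simpl psum. rewrite Ropp_plus_distr, exp_plus, IH, exp_Ropp, Hf.
      replace (m - Z.of_nat (S j))%Z with (m - Z.of_nat j - 1)%Z by lia.
      replace (m - Z.of_nat j - 1 + 1)%Z with (m - Z.of_nat j)%Z by lia.
      pose proof (D' m). pose proof (D' (m - Z.of_nat j)%Z). pose proof (D' (m - Z.of_nat j - 1)%Z).
      field. lra. }
  rewrite (psum_ext _ _ _ up), (psum_ext _ _ _ down), Hf.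
  assert (U : forall K, psum (fun j => (x (m + Z.of_nat j + 1)%Z - x (m + Z.of_nat j)%Z) / (x (m + 1)%Z - x m)) K
      = (x (m + Z.of_nat K)%Z - x m) / (x (m + 1)%Z - x m)).
  { induction K as [|K IH]; simpl psum.
    - simpl. replace (m + 0)%Z with m by lia. specialize (D m). field. lra.
    - rewrite IH. replace (m + Z.of_nat (S K))%Z with (m + Z.of_nat K + 1)%Z by lia.
      specialize (D m). field. lra. }
  assert (L : forall K, psum (fun j => (x (m - Z.of_nat j)%Z - x (m - Z.of_nat j - 1)%Z) / (x m - x (m - 1)%Z)) K
      = (x m - x (m - Z.of_nat K)%Z) / (x m - x (m - 1)%Z)).
  { induction K as [|K IH]; simpl psum.
    - simpl. replace (m - 0)%Z with m by lia. specialize (D' m). field. lra.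
    - rewrite IH. replace (m - Z.of_nat (S K))%Z with (m - Z.of_nat K - 1)%Z by lia.
      specialize (D' m). field. lra. }
  rewrite U, L.
  assert (N : forall K, 0 < x m - x (m - Z.of_nat (S K))%Z).
  { induction K as [|K IH]; [apply D'|].
    specialize (D' (m - Z.of_nat (S K))%Z).
    replace (m - Z.of_nat (S (S K)))%Z with (m - Z.of_nat (S K) - 1)%Z by lia. lra. }
  specialize (N k). pose proof (D m). pose proof (D' m). field. repeat split; lra.
Qed.

(** * Order-preserving circle maps read in fan coordinates *)

Definition circle_map (h : C -> C) : Prop :=
  (forall z, on_S1 z -> on_S1 (h z)) /\ orient_pres h.

Lemma det_neq_sym (u v : vec) : det u v <> 0 -> det v u <> 0.
Proof. rewrite (det_antisym v u). lra. Qed.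

(** The direction [u + v] completes the two points to a counterclockwise triple; the image triple is
    again counterclockwise, hence has distinct entries. *)
Lemma circle_map_inj (h : C -> C) (a b : C) : circle_map h -> on_S1 a -> on_S1 b ->
  a <> b -> h a <> h b.
Proof.
  intros [H1 H2] Sa Sb N. pose proof (pt_surj a Sa) as (u & Hu & ->).
  pose proof (pt_surj b Sb) as (v & Hv & ->).
  rewrite pt_eq_det in N by trivial.
  assert (Hm : 0 < normsq (comb 1 u 1 v))
    by (apply (normsq_pos _ u); rewrite det_comb_l, det_self, (det_antisym u v); lra).
  assert (P : 0 < det u v * det u v) by nra.
  destruct (Rlt_or_le 0 (det u v)) as [L|L].
  - assert (K : ccw3 (pt u) (pt (comb 1 u 1 v)) (pt v)).
    { apply ccw3_pt; trivial. rewrite det_comb_l, det_comb_r, !det_self, (det_antisym u v).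
      assert (0 < det u v * det u v * det u v) by nra. lra. }
    apply H2, ccw3_neq in K; auto using pt_on_S1. intuition congruence.
  - assert (K : ccw3 (pt v) (pt (comb 1 u 1 v)) (pt u)).
    { apply ccw3_pt; trivial. rewrite det_comb_l, det_comb_r, !det_self, (det_antisym u v).
      assert (0 < det u v * det u v * - det u v) by nra. lra. }
    apply H2, ccw3_neq in K; auto using pt_on_S1. intuition congruence.
Qed.

(* The map [h] on the fan line [t |-> w + t v], read in the coordinate with [h (pt v)] at infinity. *)
Definition fan_coord (h : C -> C) (w v : vec) (t : R) : R :=
  coord (h (pt v)) (h (pt (comb 1 w t v))).

Lemma fan_line_pos (w v : vec) (t : R) : det w v <> 0 ->
  0 < normsq v /\ 0 < normsq (comb 1 w t v).
Proof.
  intros D. split.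
  - apply (normsq_pos _ w), det_neq_sym, D.
  - apply (normsq_pos _ v). rewrite det_comb_l, det_self. lra.
Qed.

Lemma fan_line_neq (w v : vec) (t : R) : det w v <> 0 -> pt (comb 1 w t v) <> pt v.
Proof.
  intros D. destruct (fan_line_pos w v t D). rewrite pt_eq_det by trivial.
  rewrite det_comb_l, det_self. lra.
Qed.

Lemma fan_coord_lt (h : C -> C) (w v : vec) (t t' : R) : circle_map h -> 0 < det w v ->
  t < t' -> fan_coord h w v t < fan_coord h w v t'.
Proof.
  intros Hh D L. assert (D' : det w v <> 0) by lra.
  destruct (fan_line_pos w v t D') as [P1 P2]. destruct (fan_line_pos w v t' D') as [_ P3].
  unfold fan_coord. pose proof Hh as [H1 H2].
  apply ccw3_coord; auto using pt_on_S1, circle_map_inj, fan_line_neq.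
  apply H2; auto using pt_on_S1. apply ccw3_pt; trivial.
  rewrite !det_comb_l, !det_comb_r, !det_self, (det_antisym w v).
  assert (0 < det w v * det w v * (det w v * (t' - t))) by (assert (0 < det w v * det w v) by nra; assert (0 < det w v * (t' - t)) by nra; nra).
  lra.
Qed.

Lemma pt_fan_line (w v u : vec) : det w v = 1 -> det u v <> 0 ->
  pt u = pt (comb 1 w (det w u / det u v) v).
Proof.
  intros D N. apply pt_eq_det.
  - apply (normsq_pos _ v), N.
  - apply fan_line_pos. lra.
  - rewrite det_comb_r, (det_antisym w u). field. exact N.
Qed.

Lemma zpt_fan (w v : Z * Z) (n : Z) : zpt (zcomb 1 w n v) = pt (comb 1 (zvec w) (IZR n) (zvec v)).
Proof. unfold zpt. rewrite zvec_zcomb. reflexivity. Qed.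

Lemma shear_ratio_fan (h : C -> C) (w v : Z * Z) (n : Z) :
  circle_map h -> zdet w v = 1%Z ->
  let Y t := fan_coord h (zvec w) (zvec v) t in
  shear_ratio (h (zpt v)) (h (zpt (zcomb 1 w n v))) (h (zpt (zcomb 1 w (n + 1) v)))
    (h (zpt (zcomb 1 w (n - 1) v)))
  = (Y (IZR (n + 1)) - Y (IZR n)) / (Y (IZR n) - Y (IZR (n - 1))).
Proof.
  intros Hh D Y.
  assert (Dr : det (zvec w) (zvec v) = 1) by (rewrite det_zvec, D; reflexivity).
  assert (D' : det (zvec w) (zvec v) <> 0) by lra.
  destruct (fan_line_pos _ _ 0 D') as [P1 _].
  assert (P2 : forall t, 0 < normsq (comb 1 (zvec w) t (zvec v))) by (intros; apply fan_line_pos, D').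
  pose proof (proj1 Hh) as H1.
  rewrite !zpt_fan. change (zpt v) with (pt (zvec v)).
  rewrite shear_coord_fst; auto using pt_on_S1, circle_map_inj, fan_line_neq.
  apply circle_map_inj; auto using pt_on_S1.
  intros E. apply pt_eq_det in E; trivial.
  rewrite !det_comb_l, !det_comb_r, !det_self, (det_antisym (zvec w)), Dr, minus_IZR in E. lra.
Qed.

Lemma shear_fan (h : C -> C) (s : (C -> Prop) -> R) (w v : Z * Z) (n : Z) :
  circle_map h -> is_shear_of h s -> zdet w v = 1%Z ->
  let Y t := fan_coord h (zvec w) (zvec v) t in
  s (geod (zpt v) (zpt (zcomb 1 w n v)))
  = ln ((Y (IZR (n + 1)) - Y (IZR n)) / (Y (IZR n) - Y (IZR (n - 1)))).
Proof.
  intros Hh Hs D Y.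
  rewrite (Hs _ _ (zpt (zcomb 1 w (n + 1) v)) (zpt (zcomb 1 w (n - 1) v))).
  - unfold shear. f_equal. apply (shear_ratio_fan h w v n Hh D).
  - rewrite <- (zpt_opp (zcomb 1 w n v)), <- (zpt_opp (zcomb 1 w (n + 1) v)).
    replace (zopp (zcomb 1 w (n + 1) v)) with (zcomb (-1) v 1 (zopp (zcomb 1 w n v))) by zvring.
    apply vec_tri_all. unfold zdet, zcomb, zopp in *; cbn [fst snd] in *; lia.
  - rewrite <- (zpt_opp (zcomb 1 w (n - 1) v)).
    replace (zopp (zcomb 1 w (n - 1) v)) with (zcomb (-1) (zcomb 1 w n v) 1 v) by zvring.
    apply vec_tri_all. unfold zdet, zcomb, zopp in *; cbn [fst snd] in *; lia.
Qed.

Lemma fan_ratio_coord (h : C -> C) (s : (C -> Prop) -> R) (w v : Z * Z) (m : Z) (k : nat) :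
  circle_map h -> is_shear_of h s -> zdet w v = 1%Z ->
  let Y t := fan_coord h (zvec w) (zvec v) t in
  fan_ratio s (zpt v) (fun n => zpt (zcomb 1 w n v)) m k
  = (Y (IZR (m + Z.of_nat (S k))) - Y (IZR m)) / (Y (IZR m) - Y (IZR (m - Z.of_nat (S k)))).
Proof.
  intros Hh Hs D Y.
  apply (fan_ratio_telescope _ _ _ (fun n => Y (IZR n))).
  - intros n. apply fan_coord_lt; trivial; [rewrite det_zvec, D; lra | apply IZR_lt; lia].
  - intros n. apply shear_fan; trivial.
Qed.

(** The normal form of a harmonic quadruple; [harmonic_lift] brings every one to this form with
    determinant 1. *)
Lemma harmonic_quad (al ga : vec) : 0 < det al ga ->
  let b := comb 1 al 1 ga in let d := comb (-1) al 1 ga in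
  (0 < normsq al /\ 0 < normsq b /\ 0 < normsq ga /\ 0 < normsq d) /\
  ccw4 (pt al) (pt b) (pt ga) (pt d) /\ cr (pt al) (pt b) (pt ga) (pt d) = RtoC 1.
Proof.
  intros D b d.
  assert (K : 0 < normsq al /\ 0 < normsq b /\ 0 < normsq ga /\ 0 < normsq d).
  { repeat split.
    - apply (normsq_pos _ ga); lra.
    - apply (normsq_pos _ ga). unfold b. rewrite det_comb_l, det_self. lra.
    - apply (normsq_pos _ al). rewrite det_antisym. lra.
    - apply (normsq_pos _ ga). unfold d. rewrite det_comb_l, det_self. lra. }
  destruct K as (P1 & P2 & P3 & P4). split; [tauto|]. split.
  - assert (0 < det al ga * det al ga * det al ga) by (assert (0 < det al ga * det al ga) by nra; nra).
    repeat split; apply ccw3_pt; trivial; unfold b, d;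
      rewrite ?det_comb_l, ?det_comb_r, ?det_comb_l, ?det_comb_r, ?det_self, ?(det_antisym al ga); lra.
  - rewrite cr_pt; trivial; unfold b, d;
      rewrite ?det_comb_l, ?det_comb_r, ?det_comb_l, ?det_comb_r, ?det_self, ?(det_antisym al ga); try lra.
    f_equal. field. lra.
Qed.

(** Three equally spaced points of a fan line form a harmonic quadruple with the tip, and the
    cross-ratio of its image is the inverse of the fan ratio. That [M] is positive comes out of the
    positivity of this ratio. *)
Lemma shear_fan_bound (h : C -> C) (s : (C -> Prop) -> R) (M : R) :
  M_quasisymmetric M h -> is_shear_of h s ->
  forall p q, is_fan p q -> forall m k, 0 < M /\ / M <= fan_ratio s p q m k <= M.
Proof.
  intros ((g & Hg & _) & Ho & Hq) Hs p q F m k.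
  assert (Hh : circle_map h) by (split; trivial; intros z Hz; apply Hg; trivial).
  apply is_fan_vec in F as (w & v & D & -> & Hqn).
  replace q with (fun n => zpt (zcomb 1 w n v))
    by (apply FunctionalExtensionality.functional_extensionality; intros n; symmetry; apply Hqn).
  rewrite (fan_ratio_coord h) by trivial. cbv zeta.
  assert (Dr : det (zvec w) (zvec v) = 1) by (rewrite det_zvec, D; reflexivity).
  assert (Pv : forall t, 0 < normsq (comb 1 (zvec w) t (zvec v))) by (intros; apply fan_line_pos; lra).
  pose proof (proj1 (fan_line_pos _ _ 0 (eq_ind_r (fun x => x <> 0) R1_neq_R0 Dr))) as P0.
  set (K := IZR (Z.of_nat (S k))).
  assert (HK : 0 < K) by (apply IZR_lt; lia).
  pose proof (harmonic_quad (comb 1 (zvec w) (IZR m) (zvec v)) (comb 0 (zvec w) K (zvec v))) as Q.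
  cbv zeta in Q. destruct Q as (_ & Q1 & Q2).
  { rewrite det_comb_l, !det_comb_r, !det_self, Dr. lra. }
  assert (E1 : pt (comb 0 (zvec w) K (zvec v)) = pt (zvec v)).
  { apply pt_eq_det; trivial.
    - apply (normsq_pos _ (zvec w)). rewrite det_comb_l, det_self, det_antisym, Dr. lra.
    - rewrite det_comb_l, Dr, det_self. lra. }
  pose proof (pt_fan_line (zvec w) (zvec v) (comb 1 (comb 1 (zvec w) (IZR m) (zvec v)) 1 (comb 0 (zvec w) K (zvec v))) Dr) as E2.
  pose proof (pt_fan_line (zvec w) (zvec v) (comb (-1) (comb 1 (zvec w) (IZR m) (zvec v)) 1 (comb 0 (zvec w) K (zvec v))) Dr) as E3.
  rewrite ?det_comb_l, ?det_comb_r, ?det_comb_l, ?det_comb_r, ?det_self, Dr in E2, E3.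
  rewrite E1, E2, E3 in Q1, Q2 by lra. clear E1 E2 E3.
  match type of Q1 with ccw4 _ (pt (comb 1 _ ?x _)) _ (pt (comb 1 _ ?y _)) =>
    replace x with (IZR (m + Z.of_nat (S k))) in Q1, Q2 by (rewrite plus_IZR; unfold K; field);
    replace y with (IZR (m - Z.of_nat (S k))) in Q1, Q2 by (rewrite minus_IZR; unfold K; field) end.
  pose proof (Hq _ _ _ _ (pt_on_S1 _ (Pv _)) (pt_on_S1 _ (Pv _)) (pt_on_S1 _ P0) (pt_on_S1 _ (Pv _)) Q1 Q2) as B.
  rewrite <- cr_rot2 in B.
  assert (Dr' : det (zvec w) (zvec v) <> 0) by lra.
  pose proof (proj1 Hh) as H1.
  rewrite cr_coord_fst in B; auto using pt_on_S1, circle_map_inj, fan_line_neq.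
  2:{ apply circle_map_inj; auto using pt_on_S1. exact (proj1 (ccw3_neq _ _ _ (proj1 Q1))). }
  fold (fan_coord h (zvec w) (zvec v) (IZR m)) in B.
  fold (fan_coord h (zvec w) (zvec v) (IZR (m + Z.of_nat (S k)))) in B.
  fold (fan_coord h (zvec w) (zvec v) (IZR (m - Z.of_nat (S k)))) in B.
  assert (L1 : fan_coord h (zvec w) (zvec v) (IZR m) < fan_coord h (zvec w) (zvec v) (IZR (m + Z.of_nat (S k))))
    by (apply fan_coord_lt; trivial; [lra | apply IZR_lt; lia]).
  assert (L2 : fan_coord h (zvec w) (zvec v) (IZR (m - Z.of_nat (S k))) < fan_coord h (zvec w) (zvec v) (IZR m))
    by (apply fan_coord_lt; trivial; [lra | apply IZR_lt; lia]).
  set (x := fan_coord h _ _ (IZR m)) in *. set (y := fan_coord h _ _ (IZR (m + _))) in *.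
  set (z := fan_coord h _ _ (IZR (m - _))) in *.
  assert (R0 : 0 < (x - z) / (y - x)) by (apply Rdiv_lt_0_compat; lra).
  replace ((y - x) / (x - z)) with (/ ((x - z) / (y - x))) by (field; lra).
  destruct B as [B1 B2].
  assert (HM : 0 < M) by lra.
  split; [exact HM|]. split.
  - apply Rinv_le_contravar; lra.
  - rewrite <- (Rinv_inv M). apply Rinv_le_contravar; trivial. apply Rinv_0_lt_compat, HM.
Qed.

(** * Stern-Brocot levels and coarse doubling *)

(** Pairs are [(denominator, numerator)], to match [slope] below. Level 0 consists of all integers,
    so each level runs along the whole line. *)
Fixpoint sb (j : nat) (k : Z) : Z * Z :=
  match j with
  | O => (1, k)%Z
  | S j' => if Z.even k then sb j' (k / 2) else zcomb 1 (sb j' (k / 2)) 1 (sb j' (k / 2 + 1))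
  end.

Lemma double_div2 (k : Z) : (2 * k / 2 = k)%Z.
Proof. rewrite Z.mul_comm. apply Z.div_mul. lia. Qed.

Lemma double_succ_div2 (k : Z) : ((2 * k + 1) / 2 = k)%Z.
Proof. symmetry. apply (Z.div_unique _ _ _ 1); lia. Qed.

Lemma sb_even (j : nat) (k : Z) : sb (S j) (2 * k) = sb j k.
Proof. cbn [sb]. rewrite Z.even_mul, double_div2. reflexivity. Qed.

Lemma sb_odd (j : nat) (k : Z) : sb (S j) (2 * k + 1) = zcomb 1 (sb j k) 1 (sb j (k + 1)).
Proof. cbn [sb]. rewrite Z.even_add, Z.even_mul, double_succ_div2. reflexivity. Qed.

Lemma sb_even_succ (j : nat) (k : Z) : sb (S j) (2 * k + 1 + 1) = sb j (k + 1).
Proof. replace (2 * k + 1 + 1)%Z with (2 * (k + 1))%Z by lia. apply sb_even. Qed.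

Lemma parity_cases (k : Z) : exists k', (k = 2 * k' \/ k = 2 * k' + 1)%Z.
Proof.
  exists (k / 2)%Z. pose proof (Z.div_mod k 2 ltac:(lia)). pose proof (Z.mod_pos_bound k 2 ltac:(lia)). lia.
Qed.

Lemma sb_fst_pos (j : nat) : forall k, (1 <= fst (sb j k))%Z.
Proof.
  induction j as [|j IH]; intros k; [simpl; lia|].
  destruct (parity_cases k) as [k' [->| ->]]; rewrite ?sb_even, ?sb_odd; [trivial|].
  unfold zcomb; cbn [fst snd]. pose proof (IH k'). pose proof (IH (k' + 1)%Z). lia.
Qed.

Lemma sb_det (j : nat) : forall k, zdet (sb j k) (sb j (k + 1)) = 1%Z.
Proof.
  induction j as [|j IH]; intros k; [unfold zdet; cbn [sb fst snd]; lia|].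
  destruct (parity_cases k) as [k' [->| ->]]; rewrite ?sb_even_succ, ?sb_even, ?sb_odd;
    rewrite ?zdet_zcomb_l, ?zdet_zcomb_r, ?zdet_self, IH; lia.
Qed.

Lemma sb_sum (j : nat) : forall k, (Z.of_nat j + 2 <= fst (sb j k) + fst (sb j (k + 1)))%Z.
Proof.
  induction j as [|j IH]; intros k; [simpl; lia|].
  destruct (parity_cases k) as [k' [->| ->]]; rewrite ?sb_even_succ, ?sb_even, ?sb_odd;
    unfold zcomb; cbn [fst snd]; pose proof (sb_fst_pos j k'); pose proof (sb_fst_pos j (k' + 1));
    specialize (IH k'); lia.
Qed.

Definition slope (a : Z * Z) : R := IZR (snd a) / IZR (fst a).

Lemma slope_int (k : Z) : slope (1, k)%Z = IZR k.
Proof. unfold slope; simpl. field. Qed.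

Lemma slope_sub (a b : Z * Z) : (1 <= fst a)%Z -> (1 <= fst b)%Z ->
  slope b - slope a = IZR (zdet a b) / (IZR (fst a) * IZR (fst b)).
Proof.
  intros Ha Hb. apply IZR_le in Ha, Hb. unfold slope, zdet. rewrite minus_IZR, !mult_IZR.
  field. lra.
Qed.

Lemma sb_slope_lt (j : nat) (k : Z) : slope (sb j k) < slope (sb j (k + 1)).
Proof.
  pose proof (sb_fst_pos j k) as H1. pose proof (sb_fst_pos j (k + 1)) as H2.
  pose proof (slope_sub _ _ H1 H2) as E. rewrite sb_det in E. apply IZR_le in H1, H2.
  assert (0 < 1 / (IZR (fst (sb j k)) * IZR (fst (sb j (k + 1))))) by (apply Rdiv_lt_0_compat; nra).
  lra.
Qed.

(** Neighbours differ by the inverse product of their denominators, and a product of two numbers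
    that are at least 1 is at least their sum minus 1. *)
Lemma sb_mesh (j : nat) (k : Z) : slope (sb j (k + 1)) - slope (sb j k) <= 1 / (INR j + 1).
Proof.
  pose proof (sb_fst_pos j k) as H1. pose proof (sb_fst_pos j (k + 1)) as H2.
  rewrite (slope_sub _ _ H1 H2), sb_det. pose proof (sb_sum j k) as H3.
  rewrite INR_IZR_INZ.
  apply IZR_le in H1, H2, H3. rewrite !plus_IZR in H3.
  assert (0 <= IZR (Z.of_nat j)) by (apply IZR_le; lia).
  unfold Rdiv. rewrite !Rmult_1_l. apply Rinv_le_contravar; [lra|]. nra.
Qed.

Lemma sb_locate (j : nat) (t : R) : exists k, slope (sb j k) <= t < slope (sb j (k + 1)).
Proof.
  induction j as [|j [k Hk]].
  - exists (Int_part t). simpl. rewrite !slope_int, plus_IZR. pose proof (base_Int_part t). lra.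
  - destruct (Rlt_or_le t (slope (sb (S j) (2 * k + 1)))) as [L|L].
    + exists (2 * k)%Z. rewrite sb_even. lra.
    + exists (2 * k + 1)%Z. rewrite sb_even_succ. lra.
Qed.

Definition mediant_ratio (Y : R -> R) (j : nat) (k : Z) : R :=
  (Y (slope (sb (S j) (2 * k + 1))) - Y (slope (sb j k)))
  / (Y (slope (sb j (k + 1))) - Y (slope (sb (S j) (2 * k + 1)))).

Lemma mediant_between (j : nat) (k : Z) :
  slope (sb j k) < slope (sb (S j) (2 * k + 1)) < slope (sb j (k + 1)).
Proof.
  pose proof (sb_slope_lt (S j) (2 * k)) as H1. pose proof (sb_slope_lt (S j) (2 * k + 1)) as H2.
  rewrite sb_even in H1. rewrite sb_even_succ in H2. split; trivial.
Qed.

(* What the shears of the Farey tesselation say about an increasing boundary function [Y]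
   normalised to fix infinity. *)
Record shear_bounded (M : R) (Y : R -> R) : Prop := {
  sbd_incr : forall t t', t < t' -> Y t < Y t';
  sbd_right : forall (m : Z) (n : nat),
    Y (IZR (m + Z.of_nat (S n))) - Y (IZR m) <= M * (Y (IZR m) - Y (IZR (m - Z.of_nat (S n))));
  sbd_left : forall (m : Z) (n : nat),
    Y (IZR m) - Y (IZR (m - Z.of_nat (S n))) <= M * (Y (IZR (m + Z.of_nat (S n))) - Y (IZR m));
  sbd_base : forall k, / M <= mediant_ratio Y 0 k <= M;
  sbd_even : forall j k,
    / M <= mediant_ratio Y (S j) (2 * k) / (1 + mediant_ratio Y j k) <= M;
  sbd_odd : forall j k,
    / M <= mediant_ratio Y (S j) (2 * k + 1) * (1 + mediant_ratio Y j k) / mediant_ratio Y j k <= M }.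

Lemma mediant_ratio_pos (Y : R -> R) (j : nat) (k : Z) :
  (forall t t', t < t' -> Y t < Y t') -> 0 < mediant_ratio Y j k.
Proof.
  intros H. destruct (mediant_between j k) as [H1 H2]. apply H in H1, H2.
  apply Rdiv_lt_0_compat; lra.
Qed.

(** The new ratio is [x (1 + q)] or [x q / (1 + q)], where [q] is the old one and [x] lies between
    [/ M] and [M]. The bound grows with [j], which is harmless because a single fixed level is used
    later. *)
Lemma mediant_ratio_bound (M : R) (j : nat) : 1 <= M -> exists K, 1 <= K /\
  forall Y, shear_bounded M Y -> forall k, / K <= mediant_ratio Y j k <= K.
Proof.
  intros HM. induction j as [|j (K & HK & IH)].
  - exists M. split; trivial. intros Y HY. apply (sbd_base _ _ HY).
  - exists (M * (1 + K)). split; [nra|]. intros Y HY k.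
    pose proof (sbd_even _ _ HY j) as He. pose proof (sbd_odd _ _ HY j) as Ho.
    assert (P : forall i l, 0 < mediant_ratio Y i l) by (intros; apply mediant_ratio_pos, (sbd_incr _ _ HY)).
    specialize (IH Y HY).
    assert (G : forall r, / K <= r -> 0 < r -> 1 <= K * r).
    { intros r H1 H2. apply (Rmult_le_compat_l K) in H1; [|lra]. rewrite Rinv_r in H1; lra. }
    assert (G' : forall K r, 0 < K -> 1 <= K * r -> / K <= r).
    { intros K' r H1 H2. apply (Rmult_le_reg_l K'); trivial. rewrite Rinv_r; lra. }
    destruct (parity_cases k) as [k' [->| ->]].
    + specialize (He k'). set (r := mediant_ratio Y (S j) (2 * k')) in *.
      pose proof (P (S j) (2 * k')%Z) as Pr. fold r in Pr. specialize (IH k'). specialize (P j k').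
      set (q := mediant_ratio Y j k') in *.
      replace r with (r / (1 + q) * (1 + q)) by (field; lra).
      assert (0 < r / (1 + q)) by (apply Rdiv_lt_0_compat; lra).
      set (x := r / (1 + q)) in *.
      assert (1 <= M * x) by (destruct He as [He _]; apply (Rmult_le_compat_l M) in He; [rewrite Rinv_r in He|]; lra).
      split; [apply G'; [nra|]|].
      * replace (M * (1 + K) * (x * (1 + q))) with (M * x * ((1 + K) * (1 + q))) by ring.
        assert (1 <= (1 + K) * (1 + q)) by nra. nra.
      * apply Rmult_le_compat; lra.
    + specialize (Ho k'). set (r := mediant_ratio Y (S j) (2 * k' + 1)) in *.
      pose proof (P (S j) (2 * k' + 1)%Z) as Pr. fold r in Pr. specialize (IH k'). specialize (P j k').
      set (q := mediant_ratio Y j k') in *.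
      assert (Px : 0 < r * (1 + q) / q) by (apply Rdiv_lt_0_compat; nra).
      assert (E : r * (1 + q) = r * (1 + q) / q * q) by (field; lra).
      set (x := r * (1 + q) / q) in *.
      assert (1 <= M * x) by (destruct Ho as [Ho _]; apply (Rmult_le_compat_l M) in Ho; [rewrite Rinv_r in Ho|]; lra).
      assert (1 <= K * q) by (apply G; lra).
      split.
      * apply G'; [nra|].
        assert (1 + q <= M * (1 + K) * (r * (1 + q))).
        { rewrite E. assert ((1 + K) * q <= M * x * ((1 + K) * q)) by nra. nra. }
        nra.
      * apply (Rmult_le_reg_r (1 + q)); [lra|]. rewrite E. nra.
Qed.

(** A mediant ratio between [/ N] and [N] leaves each part of the image interval at least the
    fraction [1 / (1 + N)] of the whole. *)
Lemma gap_bound (M : R) (j : nat) : 1 <= M -> exists K, 0 < K <= 1 /\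
  forall Y, shear_bounded M Y -> forall t, exists k,
    slope (sb j k) <= t < slope (sb j (k + 1)) /\
    K * (Y (IZR (Int_part t + 1)) - Y (IZR (Int_part t))) <= Y (slope (sb j (k + 1))) - Y (slope (sb j k)).
Proof.
  intros HM. induction j as [|j (K & HK & IH)].
  - exists 1. split; [lra|]. intros Y HY t. exists (Int_part t). simpl. rewrite !slope_int.
    pose proof (base_Int_part t). rewrite plus_IZR. lra.
  - destruct (mediant_ratio_bound M j HM) as (N & HN & HB).
    assert (PN : 0 < / (1 + N)) by (apply Rinv_0_lt_compat; lra).
    exists (K * / (1 + N)). split.
    { assert (/ (1 + N) <= 1) by (rewrite <- Rinv_1; apply Rinv_le_contravar; lra). nra. }
    intros Y HY t. destruct (IH Y HY t) as (k & Hk & Hg).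
    specialize (HB Y HY k).
    destruct (mediant_between j k) as [B1 B2]. apply (sbd_incr _ _ HY) in B1, B2.
    unfold mediant_ratio in HB.
    set (a := Y (slope (sb j k))) in *. set (b := Y (slope (sb j (k + 1)))) in *.
    set (m := Y (slope (sb (S j) (2 * k + 1)))) in *.
    set (g := Y (IZR (Int_part t + 1)) - Y (IZR (Int_part t))) in *.
    assert (HB1 : m - a <= N * (b - m)).
    { destruct HB as [_ HB]. apply (Rmult_le_compat_r (b - m)) in HB; [|lra].
      replace ((m - a) / (b - m) * (b - m)) with (m - a) in HB by (field; lra). exact HB. }
    assert (HB2 : b - m <= N * (m - a)).
    { destruct HB as [HB _]. apply (Rmult_le_compat_r (N * (b - m))) in HB; [|nra].
      replace ((m - a) / (b - m) * (N * (b - m))) with (N * (m - a)) in HB by (field; lra).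
      replace (/ N * (N * (b - m))) with (b - m) in HB by (field; lra). exact HB. }
    assert (S1 : K * / (1 + N) * g <= / (1 + N) * (b - a)).
    { replace (K * / (1 + N) * g) with (/ (1 + N) * (K * g)) by ring.
      apply Rmult_le_compat_l; lra. }
    assert (S2 : / (1 + N) * (b - a) <= m - a /\ / (1 + N) * (b - a) <= b - m).
    { split; apply (Rmult_le_reg_l (1 + N)); try lra; rewrite <- Rmult_assoc, Rinv_r; lra. }
    destruct (Rlt_or_le t (slope (sb (S j) (2 * k + 1)))) as [L|L].
    + exists (2 * k)%Z. rewrite sb_even. fold a m. lra.
    + exists (2 * k + 1)%Z. rewrite sb_even_succ. fold b m. lra.
Qed.

(** The fan condition at [n + q] bounds the next block of length [q] by [M] times the previous one,
    so each doubling costs a factor [1 + M]. *)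
Lemma integer_doubling (M : R) (Y : R -> R) (n : Z) (L i : nat) : 1 <= M -> shear_bounded M Y ->
  Y (IZR (n + 2 ^ Z.of_nat i * Z.of_nat (S L))) - Y (IZR n)
  <= (1 + M) ^ i * (Y (IZR (n + Z.of_nat (S L))) - Y (IZR n)).
Proof.
  intros HM HY. induction i as [|i IH].
  - replace (n + 2 ^ Z.of_nat 0 * Z.of_nat (S L))%Z with (n + Z.of_nat (S L))%Z by (simpl Z.of_nat; rewrite Z.pow_0_r; lia).
    simpl. lra.
  - set (q := (2 ^ Z.of_nat i * Z.of_nat (S L))%Z) in *.
    assert (Hq : (0 < q)%Z) by (apply Z.mul_pos_pos; [apply Z.pow_pos_nonneg|]; lia).
    (* Blocks in [sbd_right] have length [S n], hence the argument [q - 1]. *)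
    pose proof (sbd_right _ _ HY (n + q) (Z.to_nat (q - 1))) as R.
    replace (Z.of_nat (S (Z.to_nat (q - 1)))) with q in R by lia.
    replace (n + q - q)%Z with n in R by lia.
    replace (n + 2 ^ Z.of_nat (S i) * Z.of_nat (S L))%Z with (n + q + q)%Z.
    2:{ rewrite Nat2Z.inj_succ, Z.pow_succ_r by lia. unfold q. ring. }
    simpl pow. nra.
Qed.

(** The increment of [Y] over an integer block starting at [n] is controlled by the one over
    [[c, d]]. Doubling this block to the right and then reflecting once to the left covers the
    enlarged interval. *)
Lemma coarse_doubling (M : R) : 1 <= M -> exists K, 1 <= K /\
  forall Y, shear_bounded M Y -> forall c d, 1 / 3 <= d - c ->
    Y (d + 3 * (d - c)) - Y (c - 3 * (d - c)) <= K * (Y d - Y c).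
Proof.
  (* At level 5 the mesh is at most 1/6, half of the least length 1/3, so the gap around the
     midpoint of [[c, d]] stays inside. *)
  intros HM. destruct (gap_bound M 5 HM) as (g & Hg & HG).
  (* Five doublings to the right and one comparison with the left. *)
  assert (P5 : 1 <= (1 + M) ^ 6) by (apply pow_R1_Rle; lra).
  assert (Ig : 1 <= / g) by (rewrite <- Rinv_1; apply Rinv_le_contravar; lra).
  exists ((1 + M) ^ 6 * / g). split; [nra|].
  intros Y HY c d Hcd. pose proof (sbd_incr _ _ HY) as inc.
  assert (incl : forall t t', t <= t' -> Y t <= Y t').
  { intros t t' [L| ->]; [left; auto | right; trivial]. }
  set (t := (c + d) / 2). set (n := Int_part t). pose proof (base_Int_part t) as Bt. fold n in Bt.
  (* The enlarged interval reaches [7/2] lengths away from its midpoint [t]; the summand 1 pays for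
     rounding [t] down to [n], and 32 is five doublings. For lengths below 4 one unit block
     suffices; otherwise a block of about a quarter of the length fits into [[c, d]]. *)
  assert (K : exists L : nat, 7 / 2 * (d - c) + 1 <= 32 * INR (S L) /\ g * (Y (IZR (n + Z.of_nat (S L))) - Y (IZR n)) <= Y d - Y c).
  { destruct (Rlt_or_le (d - c) 4) as [L|L].
    - exists O. split; [simpl; lra|]. destruct (HG Y HY t) as (k & Hk & Hgap).
      eapply Rle_trans; [apply Hgap|].
      pose proof (sb_mesh 5 k) as Hm. replace (1 / (INR 5 + 1)) with (1 / 6) in Hm by (simpl; field).
      assert (Y (slope (sb 5 (k + 1))) <= Y d) by (apply incl; unfold t in Hk; lra).
      assert (Y c <= Y (slope (sb 5 k))) by (apply incl; unfold t in Hk; lra).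
      lra.
    - set (l := Int_part ((d - c) / 4)). pose proof (base_Int_part ((d - c) / 4)) as Bl. fold l in Bl.
      assert (0 < l)%Z by (apply lt_IZR; lra). assert (Hl : (1 <= l)%Z) by lia.
      exists (Z.to_nat (l - 1)). rewrite INR_IZR_INZ.
      replace (Z.of_nat (S (Z.to_nat (l - 1)))) with l by lia.
      apply IZR_le in Hl as H'. split; [lra|]. rewrite plus_IZR.
      assert (Y (IZR n + IZR l) <= Y d) by (apply incl; unfold t in Bt; lra).
      assert (Y c <= Y (IZR n)) by (apply incl; unfold t in Bt; lra).
      assert (Y (IZR n) < Y (IZR n + IZR l)) by (apply inc; lra).
      nra. }
  destruct K as (L & HL1 & HL2).
  pose proof (integer_doubling M Y n L 5 HM HY) as I.
  set (q := (2 ^ Z.of_nat 5 * Z.of_nat (S L))%Z) in *.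
  assert (Eq : IZR q = 32 * INR (S L)) by (unfold q; rewrite mult_IZR, INR_IZR_INZ; reflexivity).
  assert (Hq : (0 < q)%Z) by (unfold q; lia).
  pose proof (sbd_left _ _ HY n (Z.to_nat (q - 1))) as I2.
  replace (Z.of_nat (S (Z.to_nat (q - 1)))) with q in I2 by lia.
  assert (Y (d + 3 * (d - c)) <= Y (IZR (n + q))) by (apply incl; rewrite plus_IZR, Eq; unfold t in Bt; lra).
  assert (Y (IZR (n - q)) <= Y (c - 3 * (d - c))) by (apply incl; rewrite minus_IZR, Eq; unfold t in Bt; lra).
  set (e := Y (IZR (n + Z.of_nat (S L))) - Y (IZR n)) in *.
  assert (He : 0 < e) by (apply Rlt_0_minus, inc, IZR_lt; lia).
  apply (Rle_trans _ ((1 + M) ^ 6 * e)).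
  - simpl pow in *. nra.
  - replace ((1 + M) ^ 6 * / g * (Y d - Y c)) with ((1 + M) ^ 6 * (/ g * (Y d - Y c))) by ring.
    apply Rmult_le_compat_l; [lra|]. apply (Rmult_le_reg_l g); [lra|].
    rewrite <- Rmult_assoc, Rinv_r; lra.
Qed.

(** * Short vectors *)

(** Dirichlet approximation with a complement [w]: the Stern-Brocot intervals around [X] are
    followed until the denominator of the mediant exceeds [N]. The end on the same side of the
    mediant as [X] is then close enough, and the other end completes the basis. *)
Lemma farey_dirichlet (X N : R) : 1 <= N -> exists w v, zdet w v = 1%Z /\
  1 <= IZR (fst v) <= N /\ Rabs (IZR (snd v) - X * IZR (fst v)) <= / N.
Proof.
  intros HN.
  assert (K : forall j, (exists w v, zdet w v = 1%Z /\
      1 <= IZR (fst v) <= N /\ Rabs (IZR (snd v) - X * IZR (fst v)) <= / N) \/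
      exists k, slope (sb j k) <= X < slope (sb j (k + 1)) /\
        IZR (fst (sb j k)) <= N /\ IZR (fst (sb j (k + 1))) <= N).
  { induction j as [|j [IH|(k & Hk & N1 & N2)]]; [right | left; trivial |].
    - destruct (sb_locate 0 X) as [k Hk]. exists k. simpl in *. lra.
    - pose proof (sb_fst_pos j k) as P1. pose proof (sb_fst_pos j (k + 1)) as P2.
      pose proof (sb_fst_pos (S j) (2 * k + 1)) as P3. pose proof (sb_det j k) as D.
      pose proof (slope_sub _ _ P1 P3) as S1. pose proof (slope_sub _ _ P3 P2) as S2.
      rewrite sb_odd, zdet_zcomb_r, zdet_self, D in S1.
      rewrite sb_odd, zdet_zcomb_l, zdet_self, D in S2. rewrite sb_odd in P3. simpl (1 * 0 + 1 * 1)%Z in *. simpl (1 * 1 + 1 * 0)%Z in *.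
      set (a := sb j k) in *. set (b := sb j (k + 1)) in *. set (m := zcomb 1 a 1 b) in *.
      assert (Em : IZR (fst m) = IZR (fst a) + IZR (fst b)).
      { rewrite <- plus_IZR. f_equal. unfold m, zcomb; cbn [fst snd]. ring. }
      apply IZR_le in P1, P2, P3.
      destruct (Rle_or_lt (IZR (fst m)) N) as [L|L].
      + right. destruct (Rlt_or_le X (slope m)) as [LX|LX].
        * exists (2 * k)%Z. rewrite sb_odd, sb_even. fold a b m. repeat split; lra.
        * exists (2 * k + 1)%Z. rewrite sb_even_succ, sb_odd. fold a b m. repeat split; lra.
      + left.
        assert (I : / IZR (fst m) <= / N) by (apply Rinv_le_contravar; lra).
        destruct (Rlt_or_le X (slope m)) as [LX|LX].
        * exists (zopp b), a. split; [|split; [lra|]].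
          { rewrite <- D. unfold zdet, zopp; cbn [fst snd]. ring. }
          replace (IZR (snd a) - X * IZR (fst a)) with (- (IZR (fst a) * (X - slope a)))
            by (unfold slope; field; lra).
          rewrite Rabs_Ropp, Rabs_pos_eq by (apply Rmult_le_pos; lra).
          apply (Rle_trans _ (IZR (fst a) * (slope m - slope a))); [apply Rmult_le_compat_l; lra|].
          rewrite S1. replace (IZR (fst a) * (1 / (IZR (fst a) * IZR (fst m)))) with (/ IZR (fst m)) by (field; lra).
          exact I.
        * exists a, b. split; [trivial|split; [lra|]].
          replace (IZR (snd b) - X * IZR (fst b)) with (IZR (fst b) * (slope b - X))
            by (unfold slope; field; lra).
          rewrite Rabs_pos_eq by (apply Rmult_le_pos; lra).
          apply (Rle_trans _ (IZR (fst b) * (slope b - slope m))); [apply Rmult_le_compat_l; lra|].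
          rewrite S2. replace (IZR (fst b) * (1 / (IZR (fst m) * IZR (fst b)))) with (/ IZR (fst m)) by (field; lra).
          exact I. }
  (* Beyond level [2 N] two neighbouring denominators cannot both be at most [N], by [sb_sum]. *)
  destruct (archimed (2 * N)) as [A _].
  destruct (K (Z.to_nat (up (2 * N)))) as [H|(k & _ & N1 & N2)]; trivial.
  exfalso. pose proof (sb_sum (Z.to_nat (up (2 * N))) k) as S.
  assert (0 < up (2 * N))%Z by (apply lt_IZR; lra).
  rewrite Z2Nat.id in S by lia. apply IZR_le in S. rewrite !plus_IZR in S. lra.
Qed.

(* Hermite's bound (up to a constant) for the unimodular form [v |-> det al v ^ 2 + det ga v ^ 2]:
   some cusp is at bounded distance from every point of the hyperbolic plane. *)
Lemma short_farey_vector (al ga : vec) : det al ga = 1 -> exists w v, zdet w v = 1%Z /\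
  det al (zvec v) ^ 2 + det ga (zvec v) ^ 2 <= 2.
Proof.
  intros D. set (A := fst al ^ 2 + fst ga ^ 2). set (B := fst al * snd al + fst ga * snd ga).
  set (F := snd al ^ 2 + snd ga ^ 2).
  assert (E : A * F - B * B = 1).
  { replace (A * F - B * B) with (det al ga ^ 2) by (unfold det, A, B, F; ring). rewrite D. ring. }
  assert (HA : 0 < A).
  { assert (0 <= A) by (unfold A; nra). assert (A <> 0) by (intros Z; rewrite Z in E; nra). lra. }
  assert (Q : forall v : Z * Z, det al (zvec v) ^ 2 + det ga (zvec v) ^ 2
     = A * (IZR (snd v) - B / A * IZR (fst v)) ^ 2 + IZR (fst v) ^ 2 / A).
  { intros v.
    replace (det al (zvec v) ^ 2 + det ga (zvec v) ^ 2)
      with (A * IZR (snd v) ^ 2 - 2 * B * IZR (snd v) * IZR (fst v) + F * IZR (fst v) ^ 2)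
      by (unfold det, zvec, A, B, F; cbn [fst snd]; ring).
    replace F with ((1 + B * B) / A) by (rewrite <- E; field; lra). field. lra. }
  destruct (Rle_or_lt A 1) as [L|L].
  - exists (1, 0)%Z, (0, 1)%Z. split; [reflexivity|]. rewrite Q. cbn [fst snd].
    replace (A * (1 - B / A * 0) ^ 2 + 0 ^ 2 / A) with A by (field; lra). lra.
  (* The scale [sqrt A] balances the two terms of [Q]: each becomes at most 1. *)
  - pose proof (sqrt_sqrt A ltac:(lra)) as SA. set (N := sqrt A) in *.
    assert (HN : 1 <= N) by (unfold N; rewrite <- sqrt_1; apply sqrt_le_1; lra).
    destruct (farey_dirichlet (B / A) N HN) as (w & v & Dv & [H1 H2] & H3).
    exists w, v. split; trivial. rewrite Q.
    set (e := IZR (snd v) - B / A * IZR (fst v)) in *. set (x := IZR (fst v)) in *.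
    assert (X : x ^ 2 / A <= 1).
    { apply (Rmult_le_reg_r A); trivial. replace (x ^ 2 / A * A) with (x ^ 2) by (field; lra). nra. }
    assert (e ^ 2 <= / N * / N).
    { rewrite <- (pow2_abs e). pose proof (Rabs_pos e). assert (0 < / N) by (apply Rinv_0_lt_compat; lra). nra. }
    assert (A * e ^ 2 <= A * (/ N * / N)) by (apply Rmult_le_compat_l; lra).
    assert (A * (/ N * / N) = 1) by (rewrite <- SA; field; lra).
    lra.
Qed.

(** * Images of harmonic quadruples *)

(** Two triangles on the two sides of an edge have the same basis up to signs and order, so the
    fourth vertex is forced to be [v + w] and one formula per basis captures all shears. *)
Lemma shear_vec (h : C -> C) (s : (C -> Prop) -> R) :
  is_shear_of h s <->
  forall a b, zdet a b = 1%Z -> s (geod (zpt a) (zpt b))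
    = ln (shear_ratio (h (zpt a)) (h (zpt b)) (h (zpt (zcomb (-1) a 1 b))) (h (zpt (zcomb 1 a 1 b)))).
Proof.
  split.
  - intros Hs a b D. apply Hs; [apply vec_tri_all; trivial|].
    rewrite <- (zpt_opp a), <- (zpt_opp (zcomb 1 a 1 b)).
    replace (zopp (zcomb 1 a 1 b)) with (zcomb (-1) b 1 (zopp a)) by zvring.
    apply vec_tri_all. unfold zdet, zopp in *; cbn [fst snd] in *; lia.
  - intros H a b c d T1 T2. apply farey_tri_vec in T1 as (v & w & D & -> & -> & ->).
    apply farey_tri_vec in T2 as (w' & v' & D' & E1 & E2 & ->).
    rewrite H by trivial. unfold shear. unfold shear_ratio.
    replace (zpt (zcomb (-1) w' 1 v')) with (zpt (zcomb 1 v 1 w)); [reflexivity|].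
    destruct (zvec_pos v w ltac:(lia)) as [Pv Pw]. destruct (zvec_pos w' v' ltac:(lia)) as [Pw' Pv'].
    apply zpt_eq in E1, E2; trivial.
    pose proof (zvec_basis v w w' D) as B1. pose proof (zvec_basis v w v' D) as B2.
    rewrite (zdet_antisym w w'), E1 in B1. rewrite E2 in B2.
    set (x := zdet v w') in *. set (y := zdet v' w) in *. clearbody x y. subst w' v'.
    rewrite ?zdet_zcomb_l, ?zdet_zcomb_r, ?zdet_zcomb_l, ?zdet_zcomb_r, ?zdet_self, (zdet_antisym v w), D in D'.
    assert (X : (x * - y = 1)%Z) by lia.
    apply Z.eq_mul_1 in X as X1. rewrite Z.mul_comm in X. apply Z.eq_mul_1 in X as X2.
    assert (Y : (x = 1 /\ y = -1 \/ x = -1 /\ y = 1)%Z) by lia.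
    destruct Y as [[-> ->]|[-> ->]].
    + rewrite <- zpt_opp. f_equal. zvring.
    + f_equal. zvring.
Qed.

(** The fan condition with [k = 0] bounds a single shear; the edge has index 0 in the fan of the
    basis [(-b, a)]. *)
Lemma edge_shear_bound (s : (C -> Prop) -> R) (M : R) (a b : Z * Z) :
  (forall p q, is_fan p q -> forall m k, / M <= fan_ratio s p q m k <= M) ->
  zdet a b = 1%Z -> / M <= exp (s (geod (zpt a) (zpt b))) <= M.
Proof.
  intros H D. specialize (H _ _ (vec_is_fan (zopp b) a ltac:(rewrite <- D; unfold zdet, zopp; cbn [fst snd]; ring)) 0%Z 0%nat).
  unfold fan_ratio in H. cbn [psum] in H. rewrite Ropp_0, exp_0 in H.
  replace (zcomb 1 (zopp b) 0 a) with (zopp b) in H by zvring. rewrite zpt_opp in H.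
  replace (exp (s (geod (zpt a) (zpt b))) * (0 + 1) / (0 + 1)) with (exp (s (geod (zpt a) (zpt b)))) in H by field.
  exact H.
Qed.

(** * Shears along Stern-Brocot edges, transported to an arbitrary fan *)

Section FanLine.
Variables (h : C -> C) (w v : Z * Z).
Hypotheses (Hh : circle_map h) (D : zdet w v = 1%Z).

(** The element of SL2(Z) that carries the standard cusp [(0, 1)] to [v]; it transports the
    Stern-Brocot levels to every fan line. *)
Definition fan_vec (e : Z * Z) : Z * Z := zcomb (fst e) w (snd e) v.

Lemma zdet_fan_vec (a b : Z * Z) : zdet (fan_vec a) (fan_vec b) = zdet a b.
Proof.
  unfold fan_vec. rewrite !zdet_zcomb_l, !zdet_zcomb_r, !zdet_self, (zdet_antisym w v), D.
  unfold zdet. ring.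
Qed.

Lemma zpt_fan_vec (e : Z * Z) : fst e <> 0%Z ->
  zpt (fan_vec e) = pt (comb 1 (zvec w) (slope e) (zvec v)).
Proof.
  intros He. apply eq_IZR_contrapositive in He.
  assert (Dr : det (zvec w) (zvec v) = 1) by (rewrite det_zvec, D; reflexivity).
  unfold zpt. rewrite (pt_fan_line (zvec w) (zvec v)) by (trivial;
     unfold fan_vec; rewrite zvec_zcomb, det_comb_l, det_self, Dr; lra).
  unfold fan_vec. rewrite zvec_zcomb, det_comb_l, det_comb_r, !det_self, Dr. unfold slope.
  do 2 f_equal. field. trivial.
Qed.

Let Y := fan_coord h (zvec w) (zvec v).

Lemma shear_ratio_fan_vec (a b c d : Z * Z) :
  fst a <> 0%Z -> fst b <> 0%Z -> fst c <> 0%Z -> fst d <> 0%Z ->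
  slope b <> slope d -> slope c <> slope a ->
  shear_ratio (h (zpt (fan_vec a))) (h (zpt (fan_vec b))) (h (zpt (fan_vec c))) (h (zpt (fan_vec d)))
  = (Y (slope c) - Y (slope b)) * (Y (slope d) - Y (slope a))
    / ((Y (slope b) - Y (slope d)) * (Y (slope c) - Y (slope a))).
Proof.
  intros Ha Hb Hc Hd N1 N2. rewrite !zpt_fan_vec by trivial.
  assert (Dr : det (zvec w) (zvec v) = 1) by (rewrite det_zvec, D; reflexivity).
  assert (P : forall t, 0 < normsq (comb 1 (zvec w) t (zvec v))) by (intros; apply fan_line_pos; lra).
  pose proof (proj1 (fan_line_pos _ _ 0 (eq_ind_r (fun x => x <> 0) R1_neq_R0 Dr))) as P0.
  assert (N : forall t, pt (comb 1 (zvec w) t (zvec v)) <> pt (zvec v)) by (intros; apply fan_line_neq; lra).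
  assert (N' : forall t t', t <> t' -> pt (comb 1 (zvec w) t (zvec v)) <> pt (comb 1 (zvec w) t' (zvec v))).
  { intros t t' Ht E. apply pt_eq_det in E; trivial.
    rewrite !det_comb_l, !det_comb_r, !det_self, (det_antisym (zvec w)), Dr in E. lra. }
  pose proof (proj1 Hh) as H1.
  apply shear_coord; auto using pt_on_S1, circle_map_inj.
Qed.

Lemma shear_ratio_fan_vec_inf (a b d : Z * Z) :
  fst a <> 0%Z -> fst b <> 0%Z -> fst d <> 0%Z -> slope b <> slope d ->
  shear_ratio (h (zpt (fan_vec a))) (h (zpt (fan_vec b))) (h (zpt v)) (h (zpt (fan_vec d)))
  = (Y (slope d) - Y (slope a)) / (Y (slope b) - Y (slope d)).
Proof.
  intros Ha Hb Hd N1. rewrite !zpt_fan_vec by trivial.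
  assert (Dr : det (zvec w) (zvec v) = 1) by (rewrite det_zvec, D; reflexivity).
  assert (P : forall t, 0 < normsq (comb 1 (zvec w) t (zvec v))) by (intros; apply fan_line_pos; lra).
  pose proof (proj1 (fan_line_pos _ _ 0 (eq_ind_r (fun x => x <> 0) R1_neq_R0 Dr))) as P0.
  assert (N : forall t, pt (comb 1 (zvec w) t (zvec v)) <> pt (zvec v)) by (intros; apply fan_line_neq; lra).
  assert (N' : forall t t', t <> t' -> pt (comb 1 (zvec w) t (zvec v)) <> pt (comb 1 (zvec w) t' (zvec v))).
  { intros t t' Ht E. apply pt_eq_det in E; trivial.
    rewrite !det_comb_l, !det_comb_r, !det_self, (det_antisym (zvec w)), Dr in E. lra. }
  pose proof (proj1 Hh) as H1. unfold zpt.
  apply shear_coord_thd; auto using pt_on_S1, circle_map_inj.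
Qed.

Definition edge_shear_ratio (j : nat) (k : Z) : R :=
  let a := fan_vec (sb j k) in let b := fan_vec (sb j (k + 1)) in
  shear_ratio (h (zpt a)) (h (zpt b)) (h (zpt (zcomb (-1) a 1 b))) (h (zpt (zcomb 1 a 1 b))).

Lemma fan_coord_incr (t t' : R) : t < t' -> Y t < Y t'.
Proof. apply fan_coord_lt; trivial. rewrite det_zvec, D. lra. Qed.

Lemma sb_fst_neq0 (j : nat) (k : Z) : fst (sb j k) <> 0%Z.
Proof. pose proof (sb_fst_pos j k). lia. Qed.

Lemma mediant_fan_vec (j : nat) (k : Z) :
  zcomb 1 (fan_vec (sb j k)) 1 (fan_vec (sb j (k + 1))) = fan_vec (sb (S j) (2 * k + 1)).
Proof. rewrite sb_odd. unfold fan_vec. zvring. Qed.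

Lemma edge_shear_base (k : Z) : edge_shear_ratio 0 k = mediant_ratio Y 0 k.
Proof.
  unfold edge_shear_ratio. rewrite mediant_fan_vec.
  replace (zcomb (-1) (fan_vec (sb 0 k)) 1 (fan_vec (sb 0 (k + 1)))) with v
    by (unfold fan_vec; simpl sb; zvring).
  pose proof (mediant_between 0 k).
  rewrite shear_ratio_fan_vec_inf; try apply sb_fst_neq0; try lra. reflexivity.
Qed.

(** The two triangles at this edge have as third vertices the far end of the parent interval and the
    next mediant, so the invariant involves only the two mediant ratios. Solved for the new ratio,
    this and [edge_shear_odd] give the recursion of [dev_map]. *)
Lemma edge_shear_even (j : nat) (k : Z) :
  edge_shear_ratio (S j) (2 * k) = mediant_ratio Y (S j) (2 * k) / (1 + mediant_ratio Y j k).
Proof.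
  unfold edge_shear_ratio. rewrite mediant_fan_vec.
  replace (zcomb (-1) (fan_vec (sb (S j) (2 * k))) 1 (fan_vec (sb (S j) (2 * k + 1))))
    with (fan_vec (sb j (k + 1))) by (rewrite sb_odd, sb_even; unfold fan_vec; zvring).
  pose proof (mediant_between j k) as [B1 B2]. pose proof (mediant_between (S j) (2 * k)) as [B3 B4].
  rewrite sb_even in B3.
  rewrite shear_ratio_fan_vec; try apply sb_fst_neq0; rewrite ?sb_even; try lra.
  unfold mediant_ratio. rewrite sb_even.
  apply fan_coord_incr in B1, B2, B3, B4. field. repeat split; lra.
Qed.

Lemma edge_shear_odd (j : nat) (k : Z) :
  edge_shear_ratio (S j) (2 * k + 1)
  = mediant_ratio Y (S j) (2 * k + 1) * (1 + mediant_ratio Y j k) / mediant_ratio Y j k.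
Proof.
  unfold edge_shear_ratio. rewrite mediant_fan_vec, sb_even_succ.
  assert (E : zpt (zcomb (-1) (fan_vec (sb (S j) (2 * k + 1))) 1 (fan_vec (sb j (k + 1)))) = zpt (fan_vec (sb j k))).
  { rewrite <- zpt_opp, sb_odd. f_equal. unfold fan_vec; zvring. }
  rewrite E.
  pose proof (mediant_between j k) as [B1 B2]. pose proof (mediant_between (S j) (2 * k + 1)) as [B3 B4].
  rewrite sb_even_succ in B4.
  rewrite shear_ratio_fan_vec; try apply sb_fst_neq0; try lra.
  unfold mediant_ratio. rewrite sb_even_succ.
  apply fan_coord_incr in B1, B2, B3, B4. field. repeat split; lra.
Qed.

Lemma edge_shear_ratio_pos (j : nat) (k : Z) : 0 < edge_shear_ratio j k.
Proof.
  pose proof (fun i l => mediant_ratio_pos Y i l fan_coord_incr) as P.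
  destruct j as [|j]; [rewrite edge_shear_base; apply P|].
  destruct (parity_cases k) as [k' [->| ->]]; rewrite ?edge_shear_even, ?edge_shear_odd;
    pose proof (P j k'); pose proof (P (S j) (2 * k')%Z); pose proof (P (S j) (2 * k' + 1)%Z);
    apply Rdiv_lt_0_compat; nra.
Qed.

Lemma fan_coord_shear_bounded (s : (C -> Prop) -> R) (M : R) : 1 <= M -> is_shear_of h s ->
  (forall p q, is_fan p q -> forall m k, / M <= fan_ratio s p q m k <= M) ->
  shear_bounded M Y.
Proof.
  intros HM Hs HF.
  assert (HE : forall j k, / M <= edge_shear_ratio j k <= M).
  { intros j k. assert (D' : zdet (fan_vec (sb j k)) (fan_vec (sb j (k + 1))) = 1%Z)
      by (rewrite zdet_fan_vec; apply sb_det).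
    pose proof (edge_shear_bound s M _ _ HF D') as B.
    rewrite (proj1 (shear_vec h s) Hs _ _ D') in B.
    fold (edge_shear_ratio j k) in B. rewrite exp_ln in B by apply edge_shear_ratio_pos. exact B. }
  assert (HR : forall m n, let x := Y (IZR (m + Z.of_nat (S n))) - Y (IZR m) in
     let y := Y (IZR m) - Y (IZR (m - Z.of_nat (S n))) in x <= M * y /\ y <= M * x).
  { intros m n x y. pose proof (HF _ _ (vec_is_fan w v D) m n) as B.
    rewrite (fan_ratio_coord h s) in B by trivial. cbv zeta in B. fold Y in B. fold x y in B.
    assert (Py : 0 < y) by (apply Rlt_0_minus, fan_coord_incr, IZR_lt; lia).
    assert (Px : 0 < x) by (apply Rlt_0_minus, fan_coord_incr, IZR_lt; lia).
    destruct B as [B1 B2]. split.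
    - apply (Rmult_le_compat_r y) in B2; [|lra]. replace (x / y * y) with x in B2 by (field; lra). exact B2.
    - apply (Rmult_le_compat_r (M * y)) in B1; [|nra].
      replace (/ M * (M * y)) with y in B1 by (field; lra).
      replace (x / y * (M * y)) with (M * x) in B1 by (field; lra). exact B1. }
  split.
  - apply fan_coord_incr.
  - intros m n. apply (HR m n).
  - intros m n. apply (HR m n).
  - intros k. rewrite <- edge_shear_base. apply HE.
  - intros j k. rewrite <- edge_shear_even. apply HE.
  - intros j k. rewrite <- edge_shear_odd. apply HE.
Qed.
End FanLine.

(** * From coarse doubling to cross-ratios of harmonic quadruples *)

Definition coarsely_doubling (K : R) (Y : R -> R) : Prop :=
  (forall t t', t < t' -> Y t < Y t') /\
  forall c d, 1 / 3 <= d - c -> Y (d + 3 * (d - c)) - Y (c - 3 * (d - c)) <= K * (Y d - Y c).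

Lemma strict_incr_le (Y : R -> R) (t t' : R) : (forall t t', t < t' -> Y t < Y t') ->
  t <= t' -> Y t <= Y t'.
Proof. intros H [L| ->]; [left; auto | right; trivial]. Qed.

Lemma doubling_right (K : R) (Y : R -> R) (c d e : R) : coarsely_doubling K Y ->
  1 / 3 <= d - c -> e - d <= 3 * (d - c) -> Y e - Y c <= K * (Y d - Y c).
Proof.
  intros [HI HD] L L2. specialize (HD c d L).
  pose proof (strict_incr_le Y e (d + 3 * (d - c)) HI ltac:(lra)).
  pose proof (strict_incr_le Y (c - 3 * (d - c)) c HI ltac:(lra)). lra.
Qed.

Lemma doubling_left (K : R) (Y : R -> R) (b c d : R) : coarsely_doubling K Y ->
  1 / 3 <= d - c -> c - b <= 3 * (d - c) -> Y d - Y b <= K * (Y d - Y c).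
Proof.
  intros [HI HD] L L2. specialize (HD c d L).
  pose proof (strict_incr_le Y d (d + 3 * (d - c)) HI ltac:(lra)).
  pose proof (strict_incr_le Y (c - 3 * (d - c)) b HI ltac:(lra)). lra.
Qed.

(** The longer of the two outer intervals controls all of [[a, d]], the shorter one controls the
    middle. *)
Lemma doubling_quad (K : R) (Y : R -> R) (a b c d : R) : coarsely_doubling K Y -> 1 <= K ->
  a < b -> b < c -> c < d -> 1 / 3 <= b - a -> 1 / 3 <= d - c -> c - b <= b - a -> c - b <= d - c ->
  (Y c - Y b) * (Y d - Y a) <= K ^ 2 * ((Y b - Y a) * (Y d - Y c)).
Proof.
  intros HY HK L1 L2 L3 L4 L5 L6 L7. pose proof (proj1 HY) as HI.
  apply HI in L1 as M1. apply HI in L2 as M2. apply HI in L3 as M3.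
  assert (P : forall x y x' y', 0 <= x -> 0 <= y -> x <= K * x' -> y <= K * y' -> x * y <= K ^ 2 * (x' * y')).
  { intros. replace (K ^ 2 * (x' * y')) with ((K * x') * (K * y')) by ring. apply Rmult_le_compat; lra. }
  destruct (Rle_or_lt (b - a) (d - c)) as [L|L].
  - pose proof (doubling_right K Y a b c HY L4 ltac:(lra)).
    pose proof (doubling_left K Y a c d HY L5 ltac:(lra)).
    apply P; lra.
  - pose proof (doubling_right K Y a b d HY L4 ltac:(lra)).
    pose proof (doubling_left K Y b c d HY L5 ltac:(lra)).
    rewrite (Rmult_comm (Y b - Y a)), (Rmult_comm (Y c - Y b)).
    rewrite (Rmult_comm (Y d - Y a)). apply P; lra.
Qed.

Definition cr_pts (h : C -> C) (al ga : vec) : R :=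
  Re (cr (h (pt al)) (h (pt (comb 1 al 1 ga))) (h (pt ga)) (h (pt (comb (-1) al 1 ga)))).

Definition vopp (u : vec) : vec := (- fst u, - snd u).

Lemma pt_vopp (u : vec) : pt (vopp u) = pt u.
Proof. unfold vopp, pt, normsq; cbn [fst snd]. f_equal; f_equal; try ring; f_equal; ring. Qed.

Ltac vring := unfold vopp, comb; apply injective_projections; cbn [fst snd]; ring.

Lemma cr_pts_opp (h : C -> C) (al ga : vec) : cr_pts h (vopp al) (vopp ga) = cr_pts h al ga.
Proof.
  unfold cr_pts.
  replace (comb 1 (vopp al) 1 (vopp ga)) with (vopp (comb 1 al 1 ga)) by vring.
  replace (comb (-1) (vopp al) 1 (vopp ga)) with (vopp (comb (-1) al 1 ga)) by vring.
  rewrite !pt_vopp. reflexivity.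
Qed.

(** A quarter turn of the basis shifts the quadruple by two places, under which the cross-ratio is
    invariant. *)
Lemma cr_pts_rot (h : C -> C) (al ga : vec) : cr_pts h (vopp ga) al = cr_pts h al ga.
Proof.
  unfold cr_pts.
  replace (comb 1 (vopp ga) 1 al) with (vopp (comb (-1) al 1 ga)) by vring.
  replace (comb (-1) (vopp ga) 1 al) with (comb 1 al 1 ga) by vring.
  rewrite !pt_vopp, cr_rot2. reflexivity.
Qed.

Section HarmonicBound.
Variables (h : C -> C) (w v : vec) (K : R).
Hypotheses (Hh : circle_map h) (D : det w v = 1).
Let Y := fan_coord h w v.
Hypotheses (HK : 1 <= K) (HY : coarsely_doubling K Y).

Lemma on_S1_img (u : vec) : 0 < normsq u -> on_S1 (h (pt u)).
Proof. intros; apply Hh, pt_on_S1; trivial. Qed.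

Lemma normsq_basis (u : vec) : det u v <> 0 \/ det w u <> 0 -> 0 < normsq u.
Proof.
  intros [H|H]; [apply (normsq_pos _ v); trivial | apply (normsq_pos _ w)].
  rewrite det_antisym. lra.
Qed.

Lemma pt_img_neq (a b : vec) : 0 < normsq a -> 0 < normsq b -> det a b <> 0 -> h (pt a) <> h (pt b).
Proof.
  intros Ha Hb N. apply circle_map_inj; auto using pt_on_S1. rewrite pt_eq_det by trivial. exact N.
Qed.

Lemma coord_line (u : vec) : det u v <> 0 -> coord (h (pt v)) (h (pt u)) = Y (det w u / det u v).
Proof. intros H. rewrite (pt_fan_line w v u) by trivial. reflexivity. Qed.

Lemma pt_inf (u : vec) : 0 < normsq u -> det u v = 0 -> pt u = pt v.
Proof. intros P H. apply pt_eq_det; trivial. apply (normsq_pos _ w). rewrite det_antisym, D. lra. Qed.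

Lemma pluecker (al ga : vec) : det al v * det w ga - det ga v * det w al = det al ga.
Proof. replace (det al ga) with (det w v * det al ga) by (rewrite D; ring). unfold det; ring. Qed.

Lemma Rdiv_sub_cross (P p Q q : R) : p <> 0 -> q <> 0 -> Q / q - P / p = (p * Q - q * P) * / (p * q).
Proof. intros; field; tauto. Qed.

Lemma Rinv_ge_third (x : R) : 0 < x <= 3 -> 1 / 3 <= / x.
Proof. intros H. unfold Rdiv; rewrite Rmult_1_l. apply Rinv_le_contravar; lra. Qed.

(** The cusp lies in the arc from the fourth point to the first, so the fan line shows the quadruple
    in its own order, with gaps [/ (p (p + q))], [/ ((p + q) q)], [/ (q (q - p))]. The middle one is
    the shortest, as [doubling_quad] requires. *)
Lemma harmonic_bound_apart (al ga : vec) : det al ga = 1 ->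
  det al v ^ 2 + det ga v ^ 2 <= 2 -> 0 < det al v < det ga v -> cr_pts h al ga <= K ^ 2.
Proof.
  intros DD S [H1 H2]. pose proof (pluecker al ga) as E. rewrite DD in E.
  set (p := det al v) in *. set (q := det ga v) in *. set (P := det w al) in *. set (Q := det w ga) in *.
  assert (Eb : det (comb 1 al 1 ga) v = p + q) by (rewrite det_comb_l; unfold p, q; ring).
  assert (Ed : det (comb (-1) al 1 ga) v = q - p) by (rewrite det_comb_l; unfold p, q; ring).
  assert (Fb : det w (comb 1 al 1 ga) = P + Q) by (rewrite det_comb_r; unfold P, Q; ring).
  assert (Fd : det w (comb (-1) al 1 ga) = Q - P) by (rewrite det_comb_r; unfold P, Q; ring).
  assert (N1 : 0 < normsq al) by (apply normsq_basis; left; fold p; lra).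
  assert (N2 : 0 < normsq ga) by (apply normsq_basis; left; fold q; lra).
  assert (N3 : 0 < normsq (comb 1 al 1 ga)) by (apply normsq_basis; left; lra).
  assert (N4 : 0 < normsq (comb (-1) al 1 ga)) by (apply normsq_basis; left; lra).
  assert (N0 : 0 < normsq v) by (apply (normsq_pos _ w); rewrite det_antisym, D; lra).
  unfold cr_pts.
  rewrite (cr_coord (h (pt v))); auto using on_S1_img;
    try (apply pt_img_neq; trivial; rewrite ?det_comb_l, ?det_comb_r, ?det_self, ?(det_antisym al ga), ?DD; fold p q; lra).
  rewrite !coord_line by (rewrite ?Eb, ?Ed; fold p q; lra).
  rewrite Eb, Ed, Fb, Fd. fold p q P Q.
  assert (ab : (P + Q) / (p + q) - P / p = / (p * (p + q))).
  { rewrite Rdiv_sub_cross by lra. replace (p * (P + Q) - (p + q) * P) with 1 by lra. ring. }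
  assert (bc : Q / q - (P + Q) / (p + q) = / ((p + q) * q)).
  { rewrite Rdiv_sub_cross by lra. replace ((p + q) * Q - q * (P + Q)) with 1 by lra. ring. }
  assert (cd : (Q - P) / (q - p) - Q / q = / (q * (q - p))).
  { rewrite Rdiv_sub_cross by lra. replace (q * (Q - P) - (q - p) * Q) with 1 by lra. ring. }
  assert (p2 : 0 < p * (p + q) <= 3) by (split; nra).
  assert (p4 : 0 < q * (q - p) <= 3) by (split; nra).
  assert (p3 : 0 < (p + q) * q) by nra.
  pose proof (Rinv_ge_third _ p2). pose proof (Rinv_ge_third _ p4).
  pose proof (Rinv_0_lt_compat _ p3).
  assert (/ ((p + q) * q) <= / (p * (p + q))) by (apply Rinv_le_contravar; nra).
  assert (/ ((p + q) * q) <= / (q * (q - p))) by (apply Rinv_le_contravar; nra).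
  set (ta := P / p) in *. set (tb := (P + Q) / (p + q)) in *. set (tc := Q / q) in *. set (td := (Q - P) / (q - p)) in *.
  pose proof (doubling_quad K Y ta tb tc td HY HK ltac:(lra) ltac:(lra) ltac:(lra) ltac:(lra) ltac:(lra) ltac:(lra) ltac:(lra)) as B.
  pose proof (proj1 HY ta tb ltac:(lra)). pose proof (proj1 HY tc td ltac:(lra)).
  assert (G : 0 < (Y tb - Y ta) * (Y td - Y tc)) by nra.
  apply (Rmult_le_reg_r ((Y tb - Y ta) * (Y td - Y tc))); trivial.
  eapply Rle_trans; [|exact B]. right. field. lra.
Qed.

(** The cusp lies in the closed arc from the first point to the second, and the fan line shows the
    order second, third, fourth, first. One of the two outer gaps is at most three times the middle
    one, and the other is bounded by the whole. *)
Lemma harmonic_bound_inside (al ga : vec) : det al ga = 1 ->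
  det al v ^ 2 + det ga v ^ 2 <= 2 -> det al v <= 0 -> 0 <= det al v + det ga v -> 0 < det ga v ->
  cr_pts h al ga <= K ^ 2.
Proof.
  intros DD S H1 H2 H3. pose proof (pluecker al ga) as E. rewrite DD in E.
  set (p := det al v) in *. set (q := det ga v) in *. set (P := det w al) in *. set (Q := det w ga) in *.
  assert (Eb : det (comb 1 al 1 ga) v = p + q) by (rewrite det_comb_l; unfold p, q; ring).
  assert (Ed : det (comb (-1) al 1 ga) v = q - p) by (rewrite det_comb_l; unfold p, q; ring).
  assert (Fb : det w (comb 1 al 1 ga) = P + Q) by (rewrite det_comb_r; unfold P, Q; ring).
  assert (Fd : det w (comb (-1) al 1 ga) = Q - P) by (rewrite det_comb_r; unfold P, Q; ring).
  destruct (harmonic_quad al ga ltac:(lra)) as ((N1 & N3 & N2 & N4) & _ & _).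
  assert (N0 : 0 < normsq v) by (apply (normsq_pos _ w); rewrite det_antisym, D; lra).
  assert (cd : (Q - P) / (q - p) - Q / q = / (q * (q - p))).
  { rewrite Rdiv_sub_cross by lra. replace (q * (Q - P) - (q - p) * Q) with 1 by lra. ring. }
  assert (p4 : 0 < q * (q - p) <= 3) by (split; nra).
  pose proof (Rinv_ge_third _ p4).
  pose proof (proj1 HY (Q / q) ((Q - P) / (q - p)) ltac:(lra)) as Lcd.
  assert (HK2 : K <= K ^ 2) by nra.
  assert (bc : 0 < p + q -> Q / q - (P + Q) / (p + q) = / ((p + q) * q)).
  { intros. rewrite Rdiv_sub_cross by lra. replace ((p + q) * Q - q * (P + Q)) with 1 by lra. ring. }
  assert (da : p < 0 -> P / p - (Q - P) / (q - p) = / (- p * (q - p))).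
  { intros. rewrite Rdiv_sub_cross by lra. replace ((q - p) * P - p * (Q - P)) with (-1) by lra. field. lra. }
  assert (small : forall x y, 0 < y -> x <= K * y -> x / y <= K ^ 2).
  { intros x y Hy Hxy. apply (Rmult_le_reg_r y); trivial. replace (x / y * y) with x by (field; lra). nra. }
  unfold cr_pts.
  (* The cusp may be the first point, the second point, or strictly between them; in the first two
     cases one outer gap becomes infinite and drops out. *)
  destruct (Req_dec p 0) as [p0|p0]; [|destruct (Req_dec (p + q) 0) as [q0|q0]].
  - rewrite (pt_inf al) by (trivial; fold p; lra).
    rewrite cr_coord_fst; auto using on_S1_img;
      try (apply pt_img_neq; trivial; rewrite ?Eb, ?Ed, ?det_comb_l, ?det_comb_r, ?det_self, ?(det_antisym al ga), ?DD; fold q; lra).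
    rewrite !coord_line by (rewrite ?Eb, ?Ed; fold q; lra).
    rewrite Eb, Ed, Fb, Fd. fold q Q.
    apply small; [lra|].
    specialize (bc ltac:(lra)).
    assert (/ ((p + q) * q) <= 3 * / (q * (q - p))).
    { rewrite p0, !Rplus_0_l, Rminus_0_r. assert (0 < / (q * q)) by (apply Rinv_0_lt_compat; nra). lra. }
    pose proof (doubling_left K Y ((P + Q) / (p + q)) (Q / q) ((Q - P) / (q - p)) HY ltac:(lra) ltac:(lra)). lra.
  - rewrite (pt_inf (comb 1 al 1 ga)) by (trivial; lra).
    rewrite cr_coord_snd; auto using on_S1_img;
      try (apply pt_img_neq; trivial; rewrite ?Eb, ?Ed, ?det_comb_l, ?det_comb_r, ?det_self, ?(det_antisym al ga), ?DD; fold p q; lra).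
    rewrite !coord_line by (rewrite ?Eb, ?Ed; fold p q; lra).
    rewrite Ed, Fd. fold p q P Q.
    apply small; [lra|].
    specialize (da ltac:(lra)).
    assert (/ (- p * (q - p)) <= 3 * / (q * (q - p))).
    { replace (- p) with q by lra. assert (0 < / (q * (q - p))) by (apply Rinv_0_lt_compat; lra). lra. }
    pose proof (doubling_right K Y (Q / q) ((Q - P) / (q - p)) (P / p) HY ltac:(lra) ltac:(lra)). lra.
  - rewrite (cr_coord (h (pt v))); auto using on_S1_img;
      try (apply pt_img_neq; trivial; rewrite ?Eb, ?Ed, ?det_comb_l, ?det_comb_r, ?det_self, ?(det_antisym al ga), ?DD; fold p q; lra).
    rewrite !coord_line by (rewrite ?Eb, ?Ed; fold p q; lra).
    rewrite Eb, Ed, Fb, Fd. fold p q P Q.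
    specialize (bc ltac:(lra)). specialize (da ltac:(lra)).
    assert (0 < / ((p + q) * q)) by (apply Rinv_0_lt_compat; nra).
    assert (0 < / (- p * (q - p))) by (apply Rinv_0_lt_compat; nra).
    set (ta := P / p) in *. set (tb := (P + Q) / (p + q)) in *. set (tc := Q / q) in *. set (td := (Q - P) / (q - p)) in *.
    pose proof (proj1 HY tb tc ltac:(lra)) as Lbc. pose proof (proj1 HY td ta ltac:(lra)) as Lda.
    assert (R : forall x y z t, 0 < x -> 0 < y -> 0 < z -> x <= K * y -> z <= t -> x * z / (t * y) <= K ^ 2).
    { intros x y z t Hx Hy Hz Hxy Hzt. apply small; [nra|].
      replace (K * (t * y)) with ((K * y) * t) by ring. apply Rmult_le_compat; lra. }
    replace ((Y tc - Y tb) * (Y td - Y ta) / ((Y tb - Y ta) * (Y td - Y tc)))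
      with ((Y tc - Y tb) * (Y ta - Y td) / ((Y ta - Y tb) * (Y td - Y tc))) by (field; lra).
    (* If [-p] is at most half of [q], the gap [tc - tb] is the one comparable with [td - tc];
       otherwise [ta - td] is. *)
    destruct (Rle_or_lt (- 2 * p) q) as [L|L].
    + apply R; try lra.
      assert (tc - tb <= 3 * (td - tc)).
      { rewrite bc, cd. apply (Rmult_le_reg_r ((p + q) * q * (q - p))); [apply Rmult_lt_0_compat; nra|].
        field_simplify; lra. }
      pose proof (doubling_left K Y tb tc td HY ltac:(lra) ltac:(lra)). lra.
    + rewrite (Rmult_comm (Y tc - Y tb)). apply R; try lra.
      assert (ta - td <= 3 * (td - tc)).
      { rewrite da, cd. apply (Rmult_le_reg_r (- p * q * (q - p))); [apply Rmult_lt_0_compat; nra|].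
        field_simplify; lra. }
      pose proof (doubling_right K Y tc td ta HY ltac:(lra) ltac:(lra)). lra.
Qed.

Lemma det_vopp_l (a b : vec) : det (vopp a) b = - det a b.
Proof. unfold det, vopp; cbn [fst snd]; ring. Qed.
Lemma det_vopp_r (a b : vec) : det a (vopp b) = - det a b.
Proof. unfold det, vopp; cbn [fst snd]; ring. Qed.

(** In the plane of [(det al v, det ga v)], [cr_pts_rot] is a rotation by a quarter turn and
    [cr_pts_opp] by a half turn. The sectors of [harmonic_bound_apart] and [harmonic_bound_inside]
    together span a quarter turn, so these symmetries cover every position of the cusp. *)
Lemma harmonic_bound (al ga : vec) : det al ga = 1 ->
  det al v ^ 2 + det ga v ^ 2 <= 2 -> cr_pts h al ga <= K ^ 2.
Proof.
  assert (rot : forall al ga, det al ga = 1 -> det (vopp ga) al = 1)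
    by (intros a b H; rewrite det_vopp_l, det_antisym; lra).
  assert (neg : forall al ga, det al ga = 1 -> det (vopp al) (vopp ga) = 1)
    by (intros a b H; rewrite det_vopp_l, det_vopp_r; lra).
  assert (main : forall al ga, det al ga = 1 -> det al v ^ 2 + det ga v ^ 2 <= 2 ->
     0 < det al v \/ det al v = 0 /\ 0 < det ga v -> cr_pts h al ga <= K ^ 2).
  { clear al ga. intros al ga DD S [H|[H1 H2]].
    2:{ apply harmonic_bound_inside; trivial; lra. }
    destruct (Rlt_or_le (det al v) (det ga v)) as [L1|L1]; [apply harmonic_bound_apart; trivial; lra|].
    destruct (Rle_or_lt 0 (det ga v)) as [L2|L2].
    - rewrite <- cr_pts_rot. apply harmonic_bound_inside; auto; rewrite ?det_vopp_l; nra.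
    - destruct (Rlt_or_le 0 (det al v + det ga v)) as [L3|L3].
      + rewrite <- cr_pts_rot. apply harmonic_bound_apart; auto; rewrite ?det_vopp_l; nra.
      + rewrite <- cr_pts_opp. apply harmonic_bound_inside; auto; rewrite ?det_vopp_l; nra. }
  intros DD S.
  destruct (Rtotal_order (det al v) 0) as [L|[L|L]].
  - rewrite <- cr_pts_opp. apply main; auto; rewrite ?det_vopp_l; [nra|lra].
  - assert (det ga v <> 0).
    { intros Z. pose proof (pluecker al ga) as E. rewrite Z, L, DD in E. lra. }
    destruct (Rlt_or_le 0 (det ga v)) as [L2|L2].
    + apply main; trivial. lra.
    + rewrite <- cr_pts_opp. apply main; auto; rewrite ?det_vopp_l; [nra|lra].
  - apply main; trivial. lra.
Qed.
End HarmonicBound.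

(** Rescaled lifts of [a] and [c] have [b] as their sum; cross-ratio 1 then forces [d] to be the
    difference. The cyclic order makes the rescaling real. *)
Lemma harmonic_lift (a b c d : C) : on_S1 a -> on_S1 b -> on_S1 c -> on_S1 d ->
  ccw4 a b c d -> cr a b c d = RtoC 1 ->
  exists al ga, det al ga = 1 /\ a = pt al /\ b = pt (comb 1 al 1 ga) /\ c = pt ga /\ d = pt (comb (-1) al 1 ga).
Proof.
  intros Sa Sb Sc Sd (c1 & c2 & c3 & c4) E.
  S1pt a a0 Pa. S1pt b b0 Pb. S1pt c c0 Pc. S1pt d d0 Pd.
  apply ccw3_pt in c1; trivial. apply ccw3_pt in c3; trivial.
  assert (Nab : det a0 b0 <> 0) by (intros Z; rewrite Z in c1; lra).
  assert (Ncd : det c0 d0 <> 0) by (intros Z; rewrite Z in c3; lra).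
  rewrite cr_pt in E by trivial. injection E as E.
  apply (f_equal (fun t => t * (det a0 b0 * det c0 d0))) in E.
  replace (det b0 c0 * det a0 d0 / (det a0 b0 * det c0 d0) * (det a0 b0 * det c0 d0)) with (det b0 c0 * det a0 d0) in E by (field; tauto).
  rewrite Rmult_1_l in E. rewrite (det_antisym a0 c0) in c1.
  set (X := det a0 c0) in *. set (U := det a0 b0) in *. set (V := det b0 c0) in *.
  assert (NX : X <> 0) by (intros Z; rewrite Z in c1; lra).
  assert (NV : V <> 0) by (intros Z; rewrite Z in c1; lra).
  assert (P : 0 < U * V / X).
  { replace (U * V / X) with (U * V * X / (X * X)) by (field; trivial). apply Rdiv_lt_0_compat; nra. }
  set (k := / sqrt (U * V / X)).
  assert (Hs : 0 < sqrt (U * V / X)) by (apply sqrt_lt_R0, P).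
  assert (Hk : k * k = X / (U * V)).
  { unfold k. rewrite <- Rinv_mult, sqrt_sqrt by lra. field. tauto. }
  assert (Nk : k <> 0) by (apply Rinv_neq_0_compat; lra).
  (* [V / X] and [U / X] are the coefficients of [b0] in the basis [(a0, c0)]; the common factor [k]
     normalises the determinant. *)
  set (x := k * (V / X)). set (y := k * (U / X)).
  assert (Nx : x <> 0) by (unfold x, Rdiv; repeat apply Rmult_integral_contrapositive_currified; auto using Rinv_neq_0_compat).
  assert (Ny : y <> 0) by (unfold y, Rdiv; repeat apply Rmult_integral_contrapositive_currified; auto using Rinv_neq_0_compat).
  assert (DD : det (comb x a0 0 c0) (comb 0 a0 y c0) = 1).
  { rewrite det_comb_l, !det_comb_r, !det_self. fold X. rewrite (det_antisym a0 c0). fold X.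
    replace (x * (0 * 0 + y * X) + 0 * (0 * - X + y * 0)) with (k * k * (U * V) / X) by (unfold x, y; field; trivial).
    rewrite Hk. field. tauto. }
  exists (comb x a0 0 c0), (comb 0 a0 y c0). split; [exact DD|].
  destruct (harmonic_quad (comb x a0 0 c0) (comb 0 a0 y c0) ltac:(lra)) as ((N1 & N3 & N2 & N4) & _ & _).
  repeat split; apply pt_eq_det; trivial;
    rewrite ?det_comb_r, ?det_comb_r, ?det_self.
  - ring.
  - fold U V. rewrite (det_antisym a0 b0). fold U V. unfold x, y. field. trivial.
  - ring.
  - rewrite (det_antisym a0 d0), (det_antisym c0 d0). unfold x, y. field_simplify; trivial.
    unfold Rdiv. apply Rmult_eq_0_compat_r. nra.
Qed.

Lemma harmonic_cr_bound (M : R) : 1 <= M -> exists K, 1 <= K /\ forall h s,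
  circle_map h -> is_shear_of h s ->
  (forall p q, is_fan p q -> forall m k, / M <= fan_ratio s p q m k <= M) ->
  forall a b c d, on_S1 a -> on_S1 b -> on_S1 c -> on_S1 d -> ccw4 a b c d -> cr a b c d = RtoC 1 ->
  Re (cr (h a) (h b) (h c) (h d)) <= K.
Proof.
  intros HM. destruct (coarse_doubling M HM) as (K & HK & HD). exists (K ^ 2). split; [nra|].
  intros h s Hh Hs HF a b c d Sa Sb Sc Sd Hc Hr.
  destruct (harmonic_lift a b c d Sa Sb Sc Sd Hc Hr) as (al & ga & DD & -> & -> & -> & ->).
  destruct (short_farey_vector al ga DD) as (w & v & Dv & S).
  pose proof (fan_coord_shear_bounded h w v Hh Dv s M HM Hs HF) as B.
  apply (harmonic_bound h (zvec w) (zvec v)); trivial.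
  - rewrite det_zvec, Dv. reflexivity.
  - split; [apply (sbd_incr _ _ B) | apply (HD _ B)].
Qed.

(** * The developing map *)

(** Extended to negative [n] so that [zsum_succ] holds on all integers. *)
Definition zsum (f : Z -> R) (n : Z) : R :=
  if (0 <=? n)%Z then psum (fun i => f (Z.of_nat i)) (Z.to_nat n)
  else - psum (fun i => f (-1 - Z.of_nat i)%Z) (Z.to_nat (- n)).

Lemma zsum_succ (f : Z -> R) (n : Z) : zsum f (n + 1) = zsum f n + f n.
Proof.
  unfold zsum. destruct (Z.leb_spec 0 n) as [L|L]; destruct (Z.leb_spec 0 (n + 1)) as [L'|L']; try lia.
  - replace (Z.to_nat (n + 1)) with (S (Z.to_nat n)) by lia. cbn [psum].
    rewrite Z2Nat.id by lia. reflexivity.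
  - replace n with (-1)%Z by lia.
    change (Z.to_nat (-1 + 1)) with 0%nat. change (Z.to_nat (- -1)) with 1%nat.
    cbn [psum]. change (-1 - Z.of_nat 0)%Z with (-1)%Z. ring.
  - replace (Z.to_nat (- n)) with (S (Z.to_nat (- (n + 1)))) by lia. cbn [psum].
    rewrite Z2Nat.id by lia. replace (-1 - - (n + 1))%Z with n by lia. ring.
Qed.

Lemma zsum_pred (f : Z -> R) (n : Z) : zsum f n = zsum f (n - 1) + f (n - 1)%Z.
Proof. rewrite <- zsum_succ. f_equal. ring. Qed.

Lemma Z_strict_mono (f : Z -> R) : (forall k, f k < f (k + 1)%Z) -> forall a b, (a < b)%Z -> f a < f b.
Proof.
  intros H a b L. replace b with (a + Z.of_nat (S (Z.to_nat (b - a - 1))))%Z by lia.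
  induction (Z.to_nat (b - a - 1)) as [|n IH].
  - replace (a + Z.of_nat 1)%Z with (a + 1)%Z by lia. apply H.
  - specialize (H (a + Z.of_nat (S n))%Z).
    replace (a + Z.of_nat (S n) + 1)%Z with (a + Z.of_nat (S (S n)))%Z in H by lia. lra.
Qed.

Section Developing.
Variable s : (C -> Prop) -> R.

(** The horocyclic lengths at the standard cusp, with gap 0 normalised to 1 so that 0 and 1 will be
    fixed. The shear at slope [n] is gap [n] over gap [n - 1], hence the index [i + 1]. *)
Definition fan_gap (n : Z) : R :=
  exp (zsum (fun i => s (geod (zpt (0, 1)%Z) (zpt (1, i + 1)%Z))) n).

Definition edge_shear (j : nat) (k : Z) : R := s (geod (zpt (sb j k)) (zpt (sb j (k + 1)))).

(* Image of [slope (sb j k)], paired with the ratio in which the image of the mediant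
   divides the image of the interval from [sb j k] to [sb j (k + 1)]. *)
Fixpoint dev_map (j : nat) (k : Z) : R * R :=
  match j with
  | O => (zsum fan_gap k, exp (edge_shear 0 k))
  | S i =>
      let (a, r) := dev_map i (k / 2) in
      let b := fst (dev_map i (k / 2 + 1)) in
      if Z.even k then (a, exp (edge_shear j k) * (1 + r))
      else ((a + r * b) / (1 + r), exp (edge_shear j k) * r / (1 + r))
  end.

Lemma dev_even (j : nat) (k : Z) :
  dev_map (S j) (2 * k) = (fst (dev_map j k), exp (edge_shear (S j) (2 * k)) * (1 + snd (dev_map j k))).
Proof.
  cbn [dev_map]. rewrite Z.even_mul, double_div2. cbn [Z.even orb]. destruct (dev_map j k). reflexivity.
Qed.

Lemma dev_odd (j : nat) (k : Z) :
  dev_map (S j) (2 * k + 1) =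
  ((fst (dev_map j k) + snd (dev_map j k) * fst (dev_map j (k + 1))) / (1 + snd (dev_map j k)),
   exp (edge_shear (S j) (2 * k + 1)) * snd (dev_map j k) / (1 + snd (dev_map j k))).
Proof.
  cbn [dev_map]. rewrite Z.even_add, Z.even_mul, double_succ_div2. cbn [Z.even orb Bool.eqb].
  destruct (dev_map j k). reflexivity.
Qed.

Lemma dev_ratio_pos (j : nat) : forall k, 0 < snd (dev_map j k).
Proof.
  induction j as [|j IH]; intros k; [apply exp_pos|].
  destruct (parity_cases k) as [k' [->| ->]]; rewrite ?dev_even, ?dev_odd; cbn [snd]; specialize (IH k').
  - apply Rmult_lt_0_compat; [apply exp_pos | lra].
  - apply Rdiv_lt_0_compat; [apply Rmult_lt_0_compat; [apply exp_pos|]|]; lra.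
Qed.

Lemma dev_lt_succ (j : nat) : forall k, fst (dev_map j k) < fst (dev_map j (k + 1)).
Proof.
  induction j as [|j IH]; intros k.
  - cbn [dev_map fst]. rewrite zsum_succ. unfold fan_gap at 3. pose proof (exp_pos (zsum (fun i => s (geod (zpt (0, 1)%Z) (zpt (1, i + 1)%Z))) k)). lra.
  - destruct (parity_cases k) as [k' [->| ->]].
    + rewrite dev_even, dev_odd. cbn [fst]. specialize (IH k'). pose proof (dev_ratio_pos j k').
      apply (Rmult_lt_reg_r (1 + snd (dev_map j k'))); [lra|]. field_simplify; [nra | lra].
    + replace (2 * k' + 1 + 1)%Z with (2 * (k' + 1))%Z by lia.
      rewrite dev_even, dev_odd. cbn [fst]. specialize (IH k'). pose proof (dev_ratio_pos j k').
      apply (Rmult_lt_reg_r (1 + snd (dev_map j k'))); [lra|]. field_simplify; [nra | lra].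
Qed.

Lemma sb_refine (i j : nat) (k : Z) : sb (i + j) (2 ^ Z.of_nat i * k) = sb j k.
Proof.
  induction i as [|i IH]; [simpl Z.of_nat; rewrite Z.pow_0_r, Z.mul_1_l; reflexivity|].
  rewrite Nat2Z.inj_succ, Z.pow_succ_r, <- Z.mul_assoc by lia.
  change (S i + j)%nat with (S (i + j)). rewrite sb_even. exact IH.
Qed.

Lemma dev_refine (i j : nat) (k : Z) : fst (dev_map (i + j) (2 ^ Z.of_nat i * k)) = fst (dev_map j k).
Proof.
  induction i as [|i IH]; [simpl Z.of_nat; rewrite Z.pow_0_r, Z.mul_1_l; reflexivity|].
  rewrite Nat2Z.inj_succ, Z.pow_succ_r, <- Z.mul_assoc by lia.
  change (S i + j)%nat with (S (i + j)). rewrite dev_even. exact IH.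
Qed.

(** Both points also occur at level [j + j'], where the order of slopes is the order of indices. *)
Lemma dev_mono (j j' : nat) (k k' : Z) :
  slope (sb j k) <= slope (sb j' k') -> fst (dev_map j k) <= fst (dev_map j' k').
Proof.
  rewrite <- (sb_refine j' j k), <- (dev_refine j' j k), <- (sb_refine j j' k'), <- (dev_refine j j' k').
  rewrite (Nat.add_comm j' j). set (a := (_ * k)%Z). set (b := (_ * k')%Z). intros H.
  destruct (Z.lt_trichotomy a b) as [L|[->|L]].
  - left. apply (Z_strict_mono (fun k => fst (dev_map (j + j') k))); trivial. intros; apply dev_lt_succ.
  - lra.
  - apply (Z_strict_mono (fun k => slope (sb (j + j') k))) in L; [lra|]. intros; apply sb_slope_lt.
Qed.

Lemma sb_dense (t t' : R) : t < t' -> exists j k, t < slope (sb j k) /\ slope (sb j (k + 1)) < t'.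
Proof.
  intros L. destruct (archimed_cor1 ((t' - t) / 2)) as (n & Hn & Pn); [lra|].
  destruct (sb_locate n ((t + t') / 2)) as [k Hk]. exists n, k.
  pose proof (sb_mesh n k). apply lt_INR in Pn. simpl in Pn.
  assert (1 / (INR n + 1) < / INR n).
  { unfold Rdiv. rewrite Rmult_1_l. apply Rinv_lt_contravar; nra. }
  lra.
Qed.

(** [H t] is the supremum of the images of the Stern-Brocot points up to [t]. It is strictly
    increasing because two such points fit between any two reals; jumps are not excluded yet. *)
Lemma developing_exists : exists H : R -> R,
  (forall t t', t < t' -> H t < H t') /\ (forall j k, H (slope (sb j k)) = fst (dev_map j k)).
Proof.
  assert (X : forall t, exists y, is_lub (fun z => exists j k, slope (sb j k) <= t /\ z = fst (dev_map j k)) y).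
  { intros t. destruct (completeness (fun z => exists j k, slope (sb j k) <= t /\ z = fst (dev_map j k))) as [y Hy].
    - destruct (sb_locate 0 t) as [k Hk]. exists (fst (dev_map 0 (k + 1))).
      intros z (j & l & Hl & ->). apply dev_mono. lra.
    - destruct (sb_locate 0 t) as [k Hk]. exists (fst (dev_map 0 k)), 0%nat, k. tauto.
    - exists y; trivial. }
  apply functional_choice in X as [H HH]. exists H.
  assert (E : forall j k, H (slope (sb j k)) = fst (dev_map j k)).
  { intros j k. destruct (HH (slope (sb j k))) as [U L]. apply Rle_antisym.
    - apply L. intros z (j' & k' & Hl & ->). apply dev_mono; trivial.
    - apply U. exists j, k. split; [lra | trivial]. }
  split; trivial.
  intros t t' Lt. destruct (sb_dense t t' Lt) as (j & k & L1 & L2).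
  destruct (HH t) as [_ L]. destruct (HH t') as [U _].
  apply (Rle_lt_trans _ (fst (dev_map j k))).
  - apply L. intros z (j' & k' & Hl & ->). apply dev_mono; lra.
  - apply (Rlt_le_trans _ _ _ (dev_lt_succ j k)). apply U. exists j, (k + 1)%Z. split; [lra | trivial].
Qed.

Lemma dev_mediant_ratio (H : R -> R) (j : nat) (k : Z) :
  (forall j k, H (slope (sb j k)) = fst (dev_map j k)) -> mediant_ratio H j k = snd (dev_map j k).
Proof.
  intros E. unfold mediant_ratio. rewrite !E, dev_odd. cbn [fst].
  pose proof (dev_ratio_pos j k). pose proof (dev_lt_succ j k). field. split; [lra|].
  replace (fst (dev_map j (k + 1)) * (1 + snd (dev_map j k)) - (fst (dev_map j k) + snd (dev_map j k) * fst (dev_map j (k + 1))))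
    with (fst (dev_map j (k + 1)) - fst (dev_map j k)) by ring. lra.
Qed.
End Developing.

(** * Extension of an increasing function to the circle, and its shears *)

Definition circle_ext (H : R -> R) (z : C) : C :=
  if Req_EM_T (fst z) (-1) then RtoC (-1) else pt (1, H (coord (RtoC (-1)) z)).

Lemma normsq_line_pos (t : R) : 0 < normsq (1, t).
Proof. unfold normsq; cbn [fst snd]; nra. Qed.

Lemma pt_m1 : pt (0, 1) = RtoC (-1).
Proof. unfold pt, normsq; apply injective_projections; simpl; field. Qed.

Lemma coord_m1 (t : R) : coord (RtoC (-1)) (pt (1, t)) = t.
Proof.
  rewrite <- pt_m1, coord_pt; unfold det; cbn [fst snd]; [field|lra].
Qed.

Lemma S1_cases (z : C) : on_S1 z -> z = RtoC (-1) \/ exists t, z = pt (1, t).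
Proof.
  intros Hz. S1pt z u Hu. destruct (Req_dec (fst u) 0) as [E|E].
  - left. rewrite <- pt_m1. apply pt_eq_det; trivial; unfold normsq, det; cbn [fst snd]; lra.
  - right. exists (snd u / fst u). apply pt_eq_det; trivial using normsq_line_pos.
    unfold det; cbn [fst snd]. field. trivial.
Qed.

Lemma circle_ext_inf (H : R -> R) : circle_ext H (RtoC (-1)) = RtoC (-1).
Proof. unfold circle_ext. simpl. destruct (Req_EM_T (-1) (-1)); [trivial|lra]. Qed.

Lemma circle_ext_pt (H : R -> R) (t : R) : circle_ext H (pt (1, t)) = pt (1, H t).
Proof.
  unfold circle_ext. rewrite coord_m1. destruct (Req_EM_T (fst (pt (1, t))) (-1)) as [E|E]; trivial.
  exfalso. pose proof (normsq_line_pos t) as P. unfold pt in E; cbn [fst snd] in E.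
  apply (f_equal (fun x => x * normsq (1, t))) in E.
  replace ((1 * 1 - t * t) / normsq (1, t) * normsq (1, t)) with (1 * 1 - t * t) in E by (field; lra).
  unfold normsq in E; cbn [fst snd] in E. lra.
Qed.

Lemma ccw3_line (a b c : R) : ccw3 (pt (1, a)) (pt (1, b)) (pt (1, c)) <->
  (a < b /\ b < c) \/ (b < c /\ c < a) \/ (c < a /\ a < b).
Proof.
  rewrite ccw3_pt by apply normsq_line_pos. unfold det; cbn [fst snd].
  replace ((1 * b - a * 1) * (1 * c - b * 1) * (1 * a - c * 1)) with ((b - a) * (c - b) * (a - c)) by ring.
  assert (P : forall x y z, 0 < x -> 0 < y -> 0 < z -> 0 < x * y * z)
    by (intros; repeat apply Rmult_lt_0_compat; trivial).
  split.
  - intros H. destruct (Rlt_or_le a b) as [L1|L1]; destruct (Rlt_or_le b c) as [L2|L2];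
      destruct (Rlt_or_le c a) as [L3|L3]; try tauto; exfalso.
    + assert (0 <= (b - a) * (b - c)) by nra. nra.
    + assert (0 <= (a - b) * (c - b)) by nra. nra.
    + assert (0 <= (a - b) * (b - c)) by nra. nra.
    + assert (0 <= (a - b) * (b - c)) by nra. nra.
  - intros [[L1 L2]|[[L1 L2]|[L1 L2]]].
    + pose proof (P (b - a) (c - b) (c - a) ltac:(lra) ltac:(lra) ltac:(lra)). lra.
    + pose proof (P (a - b) (c - b) (a - c) ltac:(lra) ltac:(lra) ltac:(lra)). lra.
    + pose proof (P (b - a) (b - c) (a - c) ltac:(lra) ltac:(lra) ltac:(lra)). lra.
Qed.

Lemma ccw3_inf (a b : R) : ccw3 (RtoC (-1)) (pt (1, a)) (pt (1, b)) <-> a < b.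
Proof.
  rewrite <- pt_m1, ccw3_pt; try apply normsq_line_pos; unfold det, normsq; cbn [fst snd]; lra.
Qed.

Lemma circle_ext_map (H : R -> R) : (forall t t', t < t' -> H t < H t') -> circle_map (circle_ext H).
Proof.
  intros HI. split.
  - intros z Hz. destruct (S1_cases z Hz) as [->|[t ->]].
    + rewrite circle_ext_inf. exact Hz.
    + rewrite circle_ext_pt. apply pt_on_S1, normsq_line_pos.
  - assert (inf : forall b c, on_S1 b -> on_S1 c -> ccw3 (RtoC (-1)) b c ->
        ccw3 (circle_ext H (RtoC (-1))) (circle_ext H b) (circle_ext H c)).
    { intros b c Sb Sc Hc. pose proof (ccw3_neq _ _ _ Hc) as (N1 & N2 & N3).
      destruct (S1_cases b Sb) as [->|[tb ->]]; [congruence|].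
      destruct (S1_cases c Sc) as [->|[tc ->]]; [congruence|].
      rewrite circle_ext_inf, !circle_ext_pt. apply (proj1 (ccw3_inf _ _)) in Hc. apply (proj2 (ccw3_inf _ _)). apply HI, Hc. }
    intros a b c Sa Sb Sc Hc.
    destruct (S1_cases a Sa) as [->|[ta ->]]; [apply inf; trivial|].
    destruct (S1_cases b Sb) as [->|[tb ->]]; [apply ccw3_rot, ccw3_rot, inf, ccw3_rot; trivial|].
    destruct (S1_cases c Sc) as [->|[tc ->]]; [apply ccw3_rot, inf, ccw3_rot, ccw3_rot; trivial|].
    rewrite !circle_ext_pt. apply ccw3_line in Hc. apply ccw3_line.
    intuition auto.
Qed.

Lemma circle_ext_fan_coord (H : R -> R) (t : R) : fan_coord (circle_ext H) (1, 0) (0, 1) t = H t.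
Proof.
  unfold fan_coord. rewrite pt_m1, circle_ext_inf.
  replace (comb 1 (1, 0) t (0, 1)) with (1, t) by (unfold comb; cbn [fst snd]; f_equal; ring).
  rewrite circle_ext_pt. apply coord_m1.
Qed.

(** Mediants are undone: the vector with the smaller denominator is subtracted from the other until
    the denominators agree, and then determinant 1 makes both equal to 1. *)
Lemma sb_edge (a b : Z * Z) : zdet a b = 1%Z -> (1 <= fst a)%Z -> (1 <= fst b)%Z ->
  exists j k, a = sb j k /\ b = sb j (k + 1).
Proof.
  enough (main : forall n a b, (fst a + fst b <= Z.of_nat n)%Z -> zdet a b = 1%Z ->
     (1 <= fst a)%Z -> (1 <= fst b)%Z -> exists j k, a = sb j k /\ b = sb j (k + 1)).
  { intros. apply (main (Z.to_nat (fst a + fst b))); trivial; lia. }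
  clear a b. induction n as [|n IH]; intros a b Hn D Ha Hb; [lia|].
  destruct (Z.lt_trichotomy (fst a) (fst b)) as [L|[L|L]].
  - destruct (IH a (zcomb (-1) a 1 b)) as (j & k & E1 & E2); trivial;
      try (unfold zcomb; cbn [fst snd]; lia).
    { rewrite zdet_zcomb_r, zdet_self, D. reflexivity. }
    exists (S j), (2 * k)%Z. rewrite sb_even, sb_odd, <- E1, <- E2. split; trivial. zvring.
  - exists 0%nat, (snd a). cbn [sb]. unfold zdet in D. rewrite <- L in D.
    assert (D' : (fst a * (snd b - snd a) = 1)%Z) by lia.
    apply Z.eq_mul_1 in D' as X. assert (fst a = 1%Z) by lia.
    split; apply injective_projections; cbn [fst snd]; lia.
  - destruct (IH (zcomb 1 a (-1) b) b) as (j & k & E1 & E2); trivial;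
      try (unfold zcomb; cbn [fst snd]; lia).
    { rewrite zdet_zcomb_l, zdet_self, D. reflexivity. }
    exists (S j), (2 * k + 1)%Z. rewrite sb_even_succ, sb_odd, <- E1, <- E2. split; trivial. zvring.
Qed.

Lemma shear_ratio_swap (a b c d : C) : shear_ratio b a d c = shear_ratio a b c d.
Proof.
  unfold shear_ratio.
  replace (Cmult (Cminus a c) (Cminus d b)) with (Cmult (Cminus b d) (Cminus c a)) by ring.
  replace (Cmult (Cminus d a) (Cminus c b)) with (Cmult (Cminus c b) (Cminus d a)) by ring.
  reflexivity.
Qed.

Section DevelopedMap.
Variables (s : (C -> Prop) -> R) (H : R -> R).
Hypotheses (HI : forall t t', t < t' -> H t < H t')
  (HE : forall j k, H (slope (sb j k)) = fst (dev_map s j k)).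

Let h := circle_ext H.

Definition shear_at (a b : Z * Z) : Prop :=
  s (geod (zpt a) (zpt b))
  = ln (shear_ratio (h (zpt a)) (h (zpt b)) (h (zpt (zcomb (-1) a 1 b))) (h (zpt (zcomb 1 a 1 b)))).

Lemma shear_at_opp (a b : Z * Z) : shear_at (zopp a) (zopp b) -> shear_at a b.
Proof.
  unfold shear_at.
  replace (zcomb (-1) (zopp a) 1 (zopp b)) with (zopp (zcomb (-1) a 1 b)) by zvring.
  replace (zcomb 1 (zopp a) 1 (zopp b)) with (zopp (zcomb 1 a 1 b)) by zvring.
  rewrite !zpt_opp. trivial.
Qed.

Lemma shear_at_swap (a b : Z * Z) : shear_at b (zopp a) -> shear_at a b.
Proof.
  unfold shear_at. rewrite <- (zpt_opp (zcomb (-1) b 1 (zopp a))).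
  replace (zopp (zcomb (-1) b 1 (zopp a))) with (zcomb 1 a 1 b) by zvring.
  replace (zcomb 1 b 1 (zopp a)) with (zcomb (-1) a 1 b) by zvring.
  rewrite zpt_opp, geod_sym, shear_ratio_swap. trivial.
Qed.

Lemma fan_coord_H : fan_coord h (zvec (1, 0)%Z) (zvec (0, 1)%Z) = H.
Proof. apply functional_extensionality; intros t. apply circle_ext_fan_coord. Qed.

Lemma fan_vec_std (e : Z * Z) : fan_vec (1, 0)%Z (0, 1)%Z e = e.
Proof. unfold fan_vec, zcomb. apply injective_projections; cbn [fst snd]; ring. Qed.

Lemma H_int (n : Z) : H (IZR n) = zsum (fan_gap s) n.
Proof. rewrite <- slope_int. exact (HE 0 n). Qed.

(** The vertex is that of slope [n]; its lift is negated to give the pair determinant 1. *)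
Lemma shear_at_inf (n : Z) : shear_at (0, 1)%Z (-1, - n)%Z.
Proof.
  unfold shear_at.
  rewrite <- (zpt_opp (-1, - n)%Z), <- (zpt_opp (zcomb (-1) _ 1 _)), <- (zpt_opp (zcomb 1 _ 1 _)).
  replace (zopp (-1, - n)%Z) with (zcomb 1 (1, 0) n (0, 1))%Z by zvring.
  replace (zopp (zcomb (-1) _ 1 _)) with (zcomb 1 (1, 0) (n + 1) (0, 1))%Z by zvring.
  replace (zopp (zcomb 1 _ 1 _)) with (zcomb 1 (1, 0) (n - 1) (0, 1))%Z by zvring.
  pose proof (shear_ratio_fan h (1, 0)%Z (0, 1)%Z n (circle_ext_map H HI) eq_refl) as E.
  cbv zeta in E. rewrite fan_coord_H, !H_int in E. rewrite E. clear E.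
  rewrite zsum_succ, (zsum_pred (fan_gap s) n).
  match goal with |- _ = ln ((?x + ?y + ?z - _) / _) =>
    replace (x + y + z - (x + y)) with z by ring; replace (x + y - x) with y by ring end.
  unfold fan_gap. rewrite (zsum_pred _ n), exp_plus.
  replace (zcomb 1 (1, 0) n (0, 1))%Z with (1, n - 1 + 1)%Z by zvring.
  match goal with |- _ = ln (?x * ?y / ?x) => replace (x * y / x) with y end.
  - rewrite ln_exp. reflexivity.
  - pose proof (exp_pos (zsum (fun i => s (geod (zpt (0, 1)%Z) (zpt (1, i + 1)%Z))) (n - 1))). field. lra.
Qed.

Lemma shear_at_sb (j : nat) (k : Z) : shear_at (sb j k) (sb j (k + 1)).
Proof.
  unfold shear_at.
  assert (E : edge_shear_ratio h (1, 0)%Z (0, 1)%Z j k = exp (edge_shear s j k)).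
  { pose proof (circle_ext_map H HI) as Hh. fold h in Hh.
    destruct j as [|j]; [|destruct (parity_cases k) as [k' [->| ->]]].
    - rewrite edge_shear_base, fan_coord_H, (dev_mediant_ratio s H _ _ HE) by trivial. reflexivity.
    - rewrite edge_shear_even, fan_coord_H, !(dev_mediant_ratio s H _ _ HE), dev_even by trivial. cbn [snd].
      pose proof (dev_ratio_pos s j k'). field. lra.
    - rewrite edge_shear_odd, fan_coord_H, !(dev_mediant_ratio s H _ _ HE), dev_odd by trivial. cbn [snd].
      pose proof (dev_ratio_pos s j k'). field. lra. }
  unfold edge_shear_ratio in E. cbv zeta in E. rewrite !fan_vec_std in E. rewrite E, ln_exp. reflexivity.
Qed.

(** By the signs of the first coordinates, an edge either ends at the standard cusp or, after a swap
    and a change of sign, joins two Stern-Brocot neighbours. *)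
Lemma circle_ext_shear : is_shear_of h s.
Proof.
  apply shear_vec. intros a b D. change (shear_at a b).
  assert (Z0 : forall a b, zdet a b = 1%Z -> fst a = 0%Z -> shear_at a b).
  { clear a b D. intros [x y] [z t] D E. unfold zdet in D; cbn [fst snd] in *. subst x.
    assert (X : (y * - z = 1)%Z) by lia. apply Z.eq_mul_1 in X as X1.
    destruct X1 as [-> | ->].
    - replace z with (-1)%Z by lia. replace t with (- - t)%Z by lia. apply shear_at_inf.
    - replace z with 1%Z by lia. apply shear_at_opp.
      replace (zopp (0, -1)%Z) with (0, 1)%Z by zvring.
      replace (zopp (1, t)%Z) with (-1, - t)%Z by zvring. apply shear_at_inf. }
  assert (P : forall a b, zdet a b = 1%Z -> (1 <= fst a)%Z -> (1 <= fst b)%Z -> shear_at a b).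
  { clear a b D. intros a b D Ha Hb. destruct (sb_edge a b D Ha Hb) as (j & k & -> & ->). apply shear_at_sb. }
  destruct (Z.lt_trichotomy (fst a) 0) as [La|[La|La]]; [|apply Z0; trivial|];
    (destruct (Z.lt_trichotomy (fst b) 0) as [Lb|[Lb|Lb]];
      [|apply shear_at_swap, Z0; trivial; rewrite <- D; unfold zdet, zopp; cbn [fst snd]; ring|]).
  - apply shear_at_opp, P; try (unfold zopp; cbn [fst snd]; lia).
    rewrite <- D. unfold zdet, zopp; cbn [fst snd]; ring.
  - apply shear_at_swap, P; try (unfold zopp; cbn [fst snd]; lia).
    rewrite <- D. unfold zdet, zopp; cbn [fst snd]; ring.
  - apply shear_at_swap, shear_at_opp, P; try (unfold zopp; cbn [fst snd]; lia).
    rewrite <- D. unfold zdet, zopp; cbn [fst snd]; ring.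
  - apply P; trivial; lia.
Qed.

Lemma circle_ext_fixes : fixes_1_i_m1 h.
Proof.
  pose proof (H_int 0) as H0. change (H 0 = 0) in H0.
  assert (H1 : H 1 = 1).
  { pose proof (H_int 1) as H1. change (IZR 1) with 1 in H1. rewrite H1.
    change 1%Z with (0 + 1)%Z. rewrite zsum_succ.
    change (0 + exp 0 = 1). rewrite exp_0. ring. }
  repeat split.
  - rewrite <- zpt_1. unfold zpt, zvec, h; cbn [fst snd]. rewrite circle_ext_pt, H0. reflexivity.
  - rewrite <- zpt_i. unfold zpt, zvec, h; cbn [fst snd]. rewrite circle_ext_pt, H1. reflexivity.
  - apply circle_ext_inf.
Qed.
End DevelopedMap.

(** Shifting a harmonic quadruple by one place keeps it harmonic and inverts the cross-ratio of its
    image, so the upper bound for all quadruples contains the lower one. *)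
Lemma harmonic_cr_two_sided (h : C -> C) (K : R) : circle_map h ->
  (forall a b c d, on_S1 a -> on_S1 b -> on_S1 c -> on_S1 d -> ccw4 a b c d -> cr a b c d = RtoC 1 ->
    Re (cr (h a) (h b) (h c) (h d)) <= K) ->
  forall a b c d, on_S1 a -> on_S1 b -> on_S1 c -> on_S1 d -> ccw4 a b c d -> cr a b c d = RtoC 1 ->
    / K <= Re (cr (h a) (h b) (h c) (h d)) <= K.
Proof.
  intros Hh HK a b c d Sa Sb Sc Sd Hc Hr. split; [|apply HK; trivial].
  pose proof Hh as [H1 _].
  destruct Hc as (c1 & c2 & c3 & c4).
  pose proof (ccw3_neq _ _ _ c1) as (Nab & Nbc & Nca). pose proof (ccw3_neq _ _ _ c3) as (Ncd & Nda & Nac).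
  assert (B : Re (cr (h b) (h c) (h d) (h a)) <= K).
  { apply HK; trivial; [repeat split; trivial|].
    rewrite cr_rot, Hr by trivial. simpl. rewrite Rinv_1. reflexivity. }
  rewrite cr_rot in B; auto using circle_map_inj. change (/ Re (cr (h a) (h b) (h c) (h d)) <= K) in B.
  assert (P : 0 < Re (cr (h a) (h b) (h c) (h d))).
  { pose proof Hh as [_ H2]. pose proof (H2 _ _ _ Sa Sb Sc c1) as i1. pose proof (H2 _ _ _ Sc Sd Sa c3) as i2.
    assert (Nbd : b <> d) by (pose proof (ccw3_neq _ _ _ c2); intuition).
    rewrite cr_coord_fst; auto using circle_map_inj.
    apply ccw3_coord in i1; auto using circle_map_inj.
    apply ccw3_rot, ccw3_rot, ccw3_coord in i2; auto using circle_map_inj.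
    apply Rdiv_lt_0_compat; lra. }
  rewrite <- (Rinv_inv (Re _)). apply Rinv_le_contravar; trivial. apply Rinv_0_lt_compat, P.
Qed.

(** * From increasing to homeomorphic *)

(** The Beurling-Ahlfors condition on the line. *)
Definition symmetric_bound (K : R) (H : R -> R) : Prop :=
  forall x t, 0 < t -> H x - H (x - t) <= K * (H (x + t) - H x) /\
                       H (x + t) - H x <= K * (H x - H (x - t)).

Lemma circle_ext_symmetric (H : R -> R) (K : R) : 0 < K ->
  (forall t t', t < t' -> H t < H t') ->
  (forall a b c d, on_S1 a -> on_S1 b -> on_S1 c -> on_S1 d -> ccw4 a b c d -> cr a b c d = RtoC 1 ->
    / K <= Re (cr (circle_ext H a) (circle_ext H b) (circle_ext H c) (circle_ext H d)) <= K) ->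
  symmetric_bound K H.
Proof.
  intros HK HI HQ x t Ht.
  assert (E0 : pt (0, - t) = RtoC (-1)).
  { rewrite <- pt_m1. apply pt_eq_det; unfold normsq, det; cbn [fst snd]; nra. }
  (* The lift [(0, - t)] of the point -1 makes sum and difference the points at [x - t] and
     [x + t]. *)
  destruct (harmonic_quad (0, - t) (1, x)) as (_ & Q1 & Q2); [unfold det; cbn [fst snd]; lra|].
  replace (comb 1 (0, - t) 1 (1, x)) with (1, x - t) in * by (unfold comb; cbn [fst snd]; f_equal; ring).
  replace (comb (-1) (0, - t) 1 (1, x)) with (1, x + t) in * by (unfold comb; cbn [fst snd]; f_equal; ring).
  rewrite E0 in *.
  assert (S0 : on_S1 (RtoC (-1))) by (rewrite <- E0; apply pt_on_S1; unfold normsq; cbn [fst snd]; nra).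
  specialize (HQ _ _ _ _ S0 (pt_on_S1 _ (normsq_line_pos _)) (pt_on_S1 _ (normsq_line_pos _)) (pt_on_S1 _ (normsq_line_pos _)) Q1 Q2).
  rewrite circle_ext_inf, !circle_ext_pt in HQ.
  assert (N : forall y, pt (1, y) <> RtoC (-1)).
  { intros y E. rewrite <- pt_m1 in E. apply pt_eq_det in E; unfold normsq, det in *; cbn [fst snd] in *; nra. }
  pose proof (HI (x - t) x ltac:(lra)). pose proof (HI x (x + t) ltac:(lra)).
  rewrite cr_coord_fst in HQ; auto using pt_on_S1, normsq_line_pos.
  2:{ intros E. apply pt_eq_det in E; auto using normsq_line_pos. unfold det in E; cbn [fst snd] in E. lra. }
  rewrite !coord_m1 in HQ.
  set (u := H x - H (x - t)) in *. set (v := H (x + t) - H x) in *.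
  assert (0 < u) by (unfold u; lra). assert (0 < v) by (unfold v; lra).
  assert (Ev : u / v * v = u) by (field; lra).
  destruct HQ as [B1 B2]. apply (Rmult_le_compat_r v) in B2; [|lra].
  apply (Rmult_le_compat_r v) in B1; [|lra]. apply (Rmult_le_compat_l K) in B1; [|lra].
  rewrite Ev in *. replace (K * (/ K * v)) with v in B1 by (field; lra). tauto.
Qed.

(** A jump of size [J] to the left of [x] gives each interval [[x - t, x - t / 2]] an image of
    length at least [J / K], and infinitely many of these fit disjointly into [[x - 1, x]]. *)
Lemma no_left_jump (H : R -> R) (K x J : R) : 0 < K -> symmetric_bound K H ->
  (forall t t', t < t' -> H t < H t') -> 0 < J -> (forall t, 0 < t -> J <= H x - H (x - t)) -> False.
Proof.
  intros HK HS HI HJ Hj.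
  assert (A : forall n, exists t, 0 < t /\ INR n * (J / K) <= H (x - t) - H (x - 1)).
  { induction n as [|n (t & Ht & IH)].
    - exists 1. simpl. lra.
    - exists (t / 2). split; [lra|].
      destruct (HS (x - t / 2) (t / 2) ltac:(lra)) as [_ B].
      replace (x - t / 2 + t / 2) with x in B by ring. replace (x - t / 2 - t / 2) with (x - t) in B by field.
      specialize (Hj (t / 2) ltac:(lra)).
      assert (J / K <= H (x - t / 2) - H (x - t)).
      { apply (Rmult_le_reg_l K); trivial. replace (K * (J / K)) with J by (field; lra). lra. }
      rewrite S_INR. lra. }
  assert (HJK : 0 < J / K) by (apply Rdiv_lt_0_compat; trivial).
  destruct (INR_unbounded ((H x - H (x - 1)) / (J / K))) as [n Hn].
  destruct (A n) as (t & Ht & B). pose proof (HI (x - t) x ltac:(lra)).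
  apply (Rmult_lt_compat_r (J / K)) in Hn; trivial.
  replace ((H x - H (x - 1)) / (J / K) * (J / K)) with (H x - H (x - 1)) in Hn by (field; lra). lra.
Qed.

(** Each passage from [t] to [2 t] adds at least [(H 1 - H 0) / K]; symmetry about 0 carries this
    over to the negative side. *)
Lemma symmetric_unbounded (H : R -> R) (K : R) : 0 < K -> symmetric_bound K H ->
  (forall t t', t < t' -> H t < H t') -> forall y, (exists t, y < H t) /\ exists t, H t < y.
Proof.
  intros HK HS HI y.
  assert (P : 0 < (H 1 - H 0) / K) by (apply Rdiv_lt_0_compat; [pose proof (HI 0 1 ltac:(lra))|]; lra).
  assert (A : forall n, exists t, 1 <= t /\ INR n * ((H 1 - H 0) / K) <= H t - H 0).
  { induction n as [|n (t & Ht & IH)].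
    - exists 1. pose proof (HI 0 1 ltac:(lra)). simpl. lra.
    - exists (t + t). split; [lra|]. destruct (HS t t ltac:(lra)) as [B _].
      replace (t - t) with 0 in B by ring.
      pose proof (strict_incr_le H 1 t HI Ht).
      assert ((H 1 - H 0) / K <= H (t + t) - H t).
      { apply (Rmult_le_reg_l K); trivial. replace (K * ((H 1 - H 0) / K)) with (H 1 - H 0) by (field; lra). lra. }
      rewrite S_INR. lra. }
  assert (U : forall y, exists t, 1 <= t /\ y < H t).
  { intros z. destruct (INR_unbounded ((z - H 0) / ((H 1 - H 0) / K))) as [n Hn].
    destruct (A n) as (t & Ht & B). exists t. split; trivial.
    set (q := (H 1 - H 0) / K) in *. apply (Rmult_lt_compat_r q) in Hn; trivial.
    replace ((z - H 0) / q * q) with (z - H 0) in Hn by (field; lra). lra. }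
  split; [destruct (U y) as (t & _ & B); exists t; exact B|].
  destruct (U (H 0 + K * (H 0 - y))) as (t & Ht & B).
  exists (- t). destruct (HS 0 t ltac:(lra)) as [_ C]. rewrite Rplus_0_l, Rminus_0_l in C.
  assert (K * (H 0 - y) < K * (H 0 - H (- t))) by lra.
  apply Rmult_lt_reg_l in H0; lra.
Qed.

Lemma symmetric_surjective (H : R -> R) (K : R) : 0 < K -> symmetric_bound K H ->
  (forall t t', t < t' -> H t < H t') -> forall y, exists x, H x = y.
Proof.
  intros HK HS HI y. destruct (symmetric_unbounded H K HK HS HI y) as [[t1 B1] [t0 B0]].
  destruct (completeness (fun t => H t <= y)) as [x [U L]].
  - exists t1. intros t Ht. destruct (Rle_or_lt t t1) as [X|X]; trivial. apply HI in X. lra.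
  - exists t0. lra.
  - exists x.
    assert (above : forall t, 0 < t -> y < H (x + t)).
    { intros t Ht. destruct (Rle_or_lt (H (x + t)) y) as [X|X]; trivial. apply U in X. lra. }
    assert (below : forall t, 0 < t -> H (x - t) <= y).
    { intros t Ht. destruct (Rle_or_lt (H (x - t)) y) as [X|X]; trivial.
      assert (x <= x - t); [|lra]. apply L. intros u Hu.
      destruct (Rle_or_lt u (x - t)) as [Z|Z]; trivial. apply HI in Z. lra. }
    destruct (Rtotal_order (H x) y) as [X|[X|X]]; trivial; exfalso.
    (* This jump is to the right of [x]; the symmetric bound mirrors it to the left at the cost of a
       factor [K]. *)
    + apply (no_left_jump H K x ((y - H x) / K) HK HS HI); [apply Rdiv_lt_0_compat; lra|].
      intros t Ht. specialize (above t Ht). destruct (HS x t Ht) as [_ B].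
      apply (Rmult_le_reg_l K); trivial. replace (K * ((y - H x) / K)) with (y - H x) by (field; lra). lra.
    + apply (no_left_jump H K x (H x - y) HK HS HI); [lra|].
      intros t Ht. specialize (below t Ht). lra.
Qed.

Lemma ccw3_open (u v z : C) : ccw3 u z v -> locally z (fun z' => ccw3 u z' v).
Proof.
  intros H.
  assert (E : forall z', ccw3 u z' v <->
     0 < (fst z' - fst u) * (snd v - snd u) - (snd z' - snd u) * (fst v - fst u)).
  { intros z'. unfold ccw3, Im, Cmult, Cconj, Cminus, Cplus, Copp; simpl. split; intros; lra. }
  apply E in H. set (e := _ - _) in H.
  (* Moving [z] by less than [e / B] in each coordinate changes the affine expression by less than
     [e]; the summand 1 makes [B] positive and the estimate strict. *)
  set (B := 1 + Rabs (snd v - snd u) + Rabs (fst v - fst u)).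
  pose proof (Rabs_pos (snd v - snd u)). pose proof (Rabs_pos (fst v - fst u)).
  assert (HB : 0 < B) by (unfold B; lra).
  assert (HeB : 0 < e / B) by (apply Rdiv_lt_0_compat; trivial).
  exists (mkposreal _ HeB). intros z' [D1 D2]. apply E.
  change (Rabs (fst z' - fst z) < e / B) in D1. change (Rabs (snd z' - snd z) < e / B) in D2.
  set (p := snd v - snd u) in *. set (q := fst v - fst u) in *.
  assert (Y1 : Rabs ((fst z' - fst z) * p) <= e / B * Rabs p).
  { rewrite Rabs_mult. apply Rmult_le_compat_r; lra. }
  assert (Y2 : Rabs ((snd z' - snd z) * q) <= e / B * Rabs q).
  { rewrite Rabs_mult. apply Rmult_le_compat_r; lra. }
  apply Rabs_le_between in Y1, Y2.
  assert (Y3 : e / B * B = e) by (field; lra).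
  set (k := e / B) in *. clearbody k. unfold B in Y3. unfold e in Y3. lra.
Qed.

(* An arc around [z] cut off by a chord orthogonal to the radius through [z]. *)
Lemma small_arc (z : C) (eps : R) : on_S1 z -> 0 < eps -> exists u v, on_S1 u /\ on_S1 v /\
  ccw3 u z v /\ forall w, on_S1 w -> ccw3 u w v -> Rabs (fst w - fst z) < eps /\ Rabs (snd w - snd z) < eps.
Proof.
  intros Sz He. apply S1_sqr in Sz. destruct z as [a b]; cbn [fst snd] in *.
  (* [c] and [d] are the cosine and sine of half the arc, parametrised rationally by [r]; the
     squared distance from [z] to an end of the arc is [2 - 2 c]. *)
  set (r := eps / 2). assert (Hr : 0 < r) by (unfold r; lra).
  set (c := (1 - r * r) / (1 + r * r)). set (d := 2 * r / (1 + r * r)).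
  assert (P : 0 < 1 + r * r) by nra.
  assert (cd : c * c + d * d = 1) by (unfold c, d; field; lra).
  assert (Hd : 0 < d) by (unfold d; apply Rdiv_lt_0_compat; lra).
  assert (Hc : 2 - 2 * c < eps * eps).
  { replace (2 - 2 * c) with (4 * (r * r) * / (1 + r * r)) by (unfold c; field; lra).
    replace (eps * eps) with (4 * (r * r)) by (unfold r; field).
    assert (/ (1 + r * r) < 1) by (rewrite <- Rinv_1 at 2; apply Rinv_lt_contravar; nra).
    assert (0 < r * r) by nra. nra. }
  assert (Hc1 : c < 1) by nra.
  assert (S1i : forall x y, x * x + y * y = 1 -> on_S1 (x, y)).
  { intros x y Hxy. unfold on_S1, Cmod; cbn [fst snd]. rewrite <- sqrt_1. f_equal. nra. }
  assert (N : (a * a + b * b) * (c * c + d * d) = 1) by (rewrite Sz, cd; ring).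
  exists (a * c + b * d, b * c - a * d), (a * c - b * d, b * c + a * d).
  assert (E : forall w1 w2, Im (Cmult (Cconj (Cminus (w1, w2) (a * c + b * d, b * c - a * d)))
      (Cminus (a * c - b * d, b * c + a * d) (a * c + b * d, b * c - a * d)))
      = 2 * d * ((w1 * a + w2 * b) - c * (a * a + b * b))).
  { intros. unfold Im, Cmult, Cconj, Cminus, Cplus, Copp; simpl. ring. }
  split; [apply S1i; lra|]. split; [apply S1i; lra|]. split.
  - unfold ccw3. rewrite E, Sz. nra.
  - intros [w1 w2] Sw Hw. apply S1_sqr in Sw. unfold ccw3 in Hw. rewrite E, Sz in Hw. cbn [fst snd] in *.
    assert (c < w1 * a + w2 * b) by nra.
    assert (D : (w1 - a) * (w1 - a) + (w2 - b) * (w2 - b) < eps * eps) by nra.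
    assert (T : forall x y, x * x + y * y < eps * eps -> Rabs x < eps).
    { intros x y Hxy. apply Rabs_def1.
      - destruct (Rlt_or_le x eps) as [|L]; trivial. assert (eps * eps <= x * x) by nra. nra.
      - destruct (Rlt_or_le (- eps) x) as [|L]; trivial. assert (eps * eps <= x * x) by nra. nra. }
    split; [apply (T _ (w2 - b)) | apply (T _ (w1 - a))]; lra.
Qed.

(** Open arcs form a neighbourhood basis, and the inverse carries an arc around [f z] to an arc
    around [z] because both maps preserve cyclic order. *)
Lemma orient_pres_continuous (f g : C -> C) : circle_map f -> circle_map g ->
  (forall z, on_S1 z -> f (g z) = z /\ g (f z) = z) -> cont_on_S1 f.
Proof.
  intros [F1 F2] [G1 G2] FG z Sz P [eps HP].
  destruct (small_arc (f z) eps (F1 z Sz) (cond_pos eps)) as (u & v & Su & Sv & Hc & Harc).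
  apply G2 in Hc; auto. rewrite (proj2 (FG z Sz)) in Hc.
  apply ccw3_open in Hc. destruct Hc as [del Hdel]. exists del. intros z' B Sz'.
  apply HP. apply Hdel in B. apply F2 in B; auto.
  rewrite (proj1 (FG u Su)), (proj1 (FG v Sv)) in B. apply Harc in B; auto.
Qed.

Lemma circle_ext_homeo (H : R -> R) : (forall t t', t < t' -> H t < H t') ->
  (forall y, exists x, H x = y) -> homeo_S1 (circle_ext H).
Proof.
  intros HI HS. apply functional_choice in HS as [G HG].
  assert (GI : forall t t', t < t' -> G t < G t').
  { intros t t' L. destruct (Rlt_or_le (G t) (G t')) as [X|X]; trivial.
    apply (strict_incr_le H _ _ HI) in X. rewrite !HG in X. lra. }
  assert (GH : forall t, G (H t) = t).
  { intros t. destruct (Rtotal_order (G (H t)) t) as [L|[L|L]]; trivial; apply HI in L; rewrite HG in L; lra. }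
  pose proof (circle_ext_map H HI) as Mh. pose proof (circle_ext_map G GI) as Mg.
  assert (FG : forall z, on_S1 z -> circle_ext H (circle_ext G z) = z /\ circle_ext G (circle_ext H z) = z).
  { intros z Sz. destruct (S1_cases z Sz) as [->|[t ->]].
    - rewrite !circle_ext_inf. tauto.
    - rewrite !circle_ext_pt, HG, GH. tauto. }
  exists (circle_ext G). split; [|split].
  - intros z Sz. repeat split; try apply FG; trivial; [apply Mh | apply Mg]; trivial.
  - apply (orient_pres_continuous _ (circle_ext G)); trivial.
  - apply (orient_pres_continuous _ (circle_ext H)); trivial. intros z Sz. specialize (FG z Sz). tauto.
Qed.

Theorem theorem1p1 (s : (C -> Prop) -> R) :
  (exists h : C -> C, quasisymmetric h /\ fixes_1_i_m1 h /\ is_shear_of h s)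
  <->
  (exists M : R, 1 <= M /\
     forall (p : C) (q : Z -> C), is_fan p q ->
     forall (m : Z) (k : nat),
       / M <= fan_ratio s p q m k <= M)%R.
Proof.
  split.
  (* The quasisymmetry constant may be below 1 as far as its definition says, hence the maximum. *)
  - intros (h & (M & HM) & _ & Hs). exists (Rmax 1 M). split; [apply Rmax_l|].
    intros p q F m k. destruct (shear_fan_bound h s M HM Hs p q F m k) as (P & B1 & B2).
    pose proof (Rmax_r 1 M). pose proof (Rmax_l 1 M).
    split; [|lra]. apply (Rle_trans _ (/ M)); trivial. apply Rinv_le_contravar; lra.
  - intros (M & HM & HF). destruct (harmonic_cr_bound M HM) as (K & HK & HQ).
    destruct (developing_exists s) as (H & HI & HE).
    pose proof (circle_ext_map H HI) as Hh.
    pose proof (circle_ext_shear s H HI HE) as Hs.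
    pose proof (harmonic_cr_two_sided _ K Hh (HQ _ s Hh Hs HF)) as HQ2.
    exists (circle_ext H). split; [|split; trivial].
    + exists K. split; [|split; [apply Hh | exact HQ2]].
      apply circle_ext_homeo; trivial. apply (symmetric_surjective H K); trivial; [lra|].
      apply circle_ext_symmetric; trivial. lra.
    + apply (circle_ext_fixes s); trivial.
Qed.
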